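(* Let $V$ be a finite set of points in the plane, with $Y_4$ and $Del^\infty$ as in the context. For each edge $(a,b)\in Del^\infty$, \[ d_{Y_4}(a,b)\le (11+7\sqrt{2})\, d_2(a,b). \]
   Context: $d_2$ denotes Euclidean distance. At each $u\in V$ the two axis-parallel lines through $u$ define four quadrants (cones of angle $\pi/2$) $Q_1(u),\dots,Q_4(u)$, labeled counterclockwise starting with the first quadrant; each cone includes its clockwise bounding ray and excludes its counterclockwise bounding ray. The directed Yao graph $\overrightarrow{Y_4}$ contains, for each $u\in V$ and each cone $Q_i(u)$ containing a point of $V\setminus\{u\}$, a directed edge from $u$ to a vertex $v\in Q_i(u)$ minimizing $d_2(u,v)$ (ties broken arbitrarily); $Y_4$ is the undirected version. $Del^\infty$ is the $L_\infty$-Delaunay triangulation of $V$: $(u,v)$ is an edge iff there is an axis-aligned square with $u$ and $v$ on its boundary and no vertex of $V$ in its interior. Edge weights are Euclidean lengths, path length is the sum of weights, and $d_{Y_4}(u,v)$ is the length of a shortest path in $Y_4$ between $u$ and $v$. *)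

(* Defs.v *)
From Stdlib Require Import Reals List.
Open Scope R_scope.

Definition pt : Type := (R * R)%type.

Definition dist2 (p q : pt) : R :=
  sqrt ((fst p - fst q) ^ 2 + (snd p - snd q) ^ 2).

(* v lies in the cone Q_i(u), i = 1..4, labelled counterclockwise starting
   with the first quadrant; each cone contains its clockwise bounding ray
   and excludes its counterclockwise bounding ray (and the apex u). *)
Definition in_cone (i : nat) (u v : pt) : Prop :=
  let dx := fst v - fst u in
  let dy := snd v - snd u in
  match i with
  | 1%nat => dx > 0 /\ dy >= 0
  | 2%nat => dx <= 0 /\ dy > 0
  | 3%nat => dx < 0 /\ dy <= 0
  | 4%nat => dx >= 0 /\ dy < 0
  | _ => False
  end.

(* E is (the edge relation of) a directed Yao graph Y4->(V), for some
   arbitrary tie-breaking: for each u in V and each nonempty cone Q_i(u)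
   there is exactly one out-edge of u into Q_i(u), and it goes to a vertex of
   V in that cone minimizing the Euclidean distance to u; there are no
   other edges. *)
Definition yao4_directed (V : list pt) (E : pt -> pt -> Prop) : Prop :=
  (forall u v, E u v ->
     In u V /\ In v V /\
     exists i, (1 <= i <= 4)%nat /\ in_cone i u v /\
       (forall w, In w V -> in_cone i u w -> dist2 u v <= dist2 u w)) /\
  (forall u i, In u V -> (1 <= i <= 4)%nat ->
     (exists w, In w V /\ in_cone i u w) ->
     exists v, E u v /\ in_cone i u v) /\
  (forall u v v' i, E u v -> E u v' -> in_cone i u v -> in_cone i u v' ->
     v = v').

Definition Y4 (E : pt -> pt -> Prop) (u v : pt) : Prop := E u v \/ E v u.

Fixpoint walk (G : pt -> pt -> Prop) (a : pt) (p : list pt) (b : pt) : Prop :=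
  match p with
  | nil => a = b
  | c :: p' => G a c /\ walk G c p' b
  end.

Fixpoint walk_len (a : pt) (p : list pt) : R :=
  match p with
  | nil => 0
  | c :: p' => dist2 a c + walk_len c p'
  end.

Definition on_square_boundary (x0 y0 s : R) (p : pt) : Prop :=
  x0 <= fst p <= x0 + s /\ y0 <= snd p <= y0 + s /\
  (fst p = x0 \/ fst p = x0 + s \/ snd p = y0 \/ snd p = y0 + s).

Definition in_square_interior (x0 y0 s : R) (p : pt) : Prop :=
  x0 < fst p < x0 + s /\ y0 < snd p < y0 + s.

Definition del_inf_edge (V : list pt) (a b : pt) : Prop :=
  In a V /\ In b V /\ a <> b /\
  exists x0 y0 s, 0 < s /\
    on_square_boundary x0 y0 s a /\ on_square_boundary x0 y0 s b /\
    (forall w, In w V -> ~ in_square_interior x0 y0 s w).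

(* Main.v *)
Require Import Defs.
From Stdlib Require Import Reals List.
From Stdlib Require Import Lra Psatz Classical Lia.
Open Scope R_scope.

(** Turning the axes by a tiny angle makes the half-open cones open sign quadrants of coordinates
    [X], [Y] that are injective on [V], while the empty square keeps its original axes [x], [y].
    If the Yao edge of [c] towards [t] jumps over [t] along the longer axis of their empty box,
    then its end is joined to [t] by a path of length at most (1 + sqrt 2) times their L1 distance:
    go down the staircase of minimal points between them, by induction on the distance.
    Scale the empty square to the unit square, with [a] on its left and [b] on its right side.
    From [a] and from [b], staircases run along the top and the bottom side of the square.
    If neither of them reaches the other point, the top one can be left by a downward Yao edge
    and the bottom one by an upward Yao edge; these two edges cross or meet, so the top staircase
    can be followed as far as the upward edge. All these paths have length at most 17.
    Other points on the boundary of the square near its corners are handled by first moving along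
    the left and right sides, or, at a corner, by induction on [D a b]. *)

(** The half-open cones are not mirror-symmetric, whereas open quadrants are permuted by reflections
    and by exchanging the axes; this is why each lemma is needed in one orientation only. The price
    is that [X], [Y] agree with [x], [y] only up to ties and up to one percent, hence the margins
    0.99 and 1.01. A step of a staircase fails in one way only: the Yao edge along the longer axis
    of the step falls short along that axis and passes the target along the shorter one. Each use of
    a staircase must exclude this, either by minimality of its points or by comparing the edge with
    another nearest-point condition, or else must turn the escaping edge into a detour. Only [kappa]
    is a tight value; all other constants are rounded up. Between the sides of the unit square the
    path costs at most 17, moving along the two sides at most 1 each, and 19 is below 20, which is
    below [11 + 7 * sqrt 2], while [a] and [b] are at distance at least 1. *)

Lemma list_argmin {A : Type} (l : list A) (m : A -> R) (P : A -> Prop) :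
  (exists a, In a l /\ P a) ->
  exists a, In a l /\ P a /\ forall b, In b l -> P b -> m a <= m b.
Proof.
  induction l as [|c l IH]; intros [a [Ha Pa]].
  - destruct Ha.
  - destruct (classic (exists a, In a l /\ P a)) as [Hl|Hl].
    + destruct (IH Hl) as [d [Hd [Pd Hmin]]].
      destruct (classic (P c /\ m c < m d)) as [[Pc Hc]|Hc].
      * exists c. split; [now left|]. split; [easy|].
        intros b [<-|Hb] Pb; [lra|]. specialize (Hmin b Hb Pb); lra.
      * exists d. split; [now right|]. split; [easy|].
        intros b [<-|Hb] Pb; [|now apply Hmin].
        apply Rnot_lt_le. tauto.
    + exists a. split; [easy|]. split; [easy|].
      destruct Ha as [->|Ha]; [|exfalso; eauto].
      intros b [<-|Hb] Pb; [lra|exfalso; eauto].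
Qed.

(** The order of the reals is not well-founded, but on a finite list a counterexample of least
    measure exists. *)
Lemma list_real_ind {A : Type} (l : list A) (m : A -> R) (P : A -> Prop) :
  (forall a, In a l -> (forall b, In b l -> m b < m a -> P b) -> P a) ->
  forall a, In a l -> P a.
Proof.
  intros step a Ha. apply NNPP. intros HN.
  destruct (list_argmin l m (fun a => ~ P a)) as [b [Hb [Nb Hmin]]]; [eauto|].
  apply Nb, step; [easy|]. intros c Hc Hlt. apply NNPP. intros Nc.
  specialize (Hmin c Hc Nc). lra.
Qed.

Lemma pair_real_ind (V : list pt) (m : pt -> pt -> R) (P : pt -> pt -> Prop) :
  (forall p q, In p V -> In q V ->
     (forall p' q', In p' V -> In q' V -> m p' q' < m p q -> P p' q') -> P p q) ->
  forall p q, In p V -> In q V -> P p q.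
Proof.
  intros step p q Hp Hq.
  assert (H : forall pq, In pq (list_prod V V) -> P (fst pq) (snd pq)).
  { apply (list_real_ind _ (fun pq => m (fst pq) (snd pq))).
    intros [p1 q1] H1 IH. apply in_prod_iff in H1. simpl in *.
    apply step; try tauto. intros p2 q2 H2 H3 Hlt.
    apply (IH (p2, q2)); [now apply in_prod|easy]. }
  apply (H (p, q)). now apply in_prod.
Qed.

(** The distance is a parameter so that the plane can be rescaled by changing [D] and the coordinate
    functions while the points and the graph stay fixed. *)
Fixpoint wlen (D : pt -> pt -> R) (a : pt) (p : list pt) : R :=
  match p with
  | nil => 0
  | c :: p' => D a c + wlen D c p'
  end.

Definition reach (G : pt -> pt -> Prop) (D : pt -> pt -> R) (p q : pt) (c : R) : Prop :=
  exists l, walk G p l q /\ wlen D p l <= c.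

Lemma reach_refl G D p c : 0 <= c -> reach G D p p c.
Proof. intros; exists nil; simpl; auto. Qed.

Lemma reach_edge G D p q c : G p q -> D p q <= c -> reach G D p q c.
Proof. intros; exists (q :: nil); simpl; split; [auto|lra]. Qed.

Lemma reach_le G D p q c c' : reach G D p q c -> c <= c' -> reach G D p q c'.
Proof. intros [l [H1 H2]] H; exists l; split; [easy|lra]. Qed.

Lemma reach_trans G D p q r c1 c2 c :
  reach G D p q c1 -> reach G D q r c2 -> c1 + c2 <= c -> reach G D p r c.
Proof.
  intros [l1 [W1 L1]] [l2 [W2 L2]] Hc.
  assert (H : walk G p (l1 ++ l2) r /\ wlen D p (l1 ++ l2) = wlen D p l1 + wlen D q l2).
  { clear L1 Hc. revert p W1. induction l1 as [|d l1 IH]; simpl; intros p W1.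
    - subst. split; [easy|lra].
    - destruct W1 as [W0 W1]. destruct (IH d W1) as [H1 H2]. split; [easy|lra]. }
  exists (l1 ++ l2). split; [easy|lra].
Qed.

Lemma reach_sym G D p q c :
  (forall u v, G u v -> G v u) -> (forall u v, D u v = D v u) ->
  reach G D p q c -> reach G D q p c.
Proof.
  intros SG SD [l [W L]].
  enough (H : reach G D q p (wlen D p l)) by (eapply reach_le; eauto).
  clear L. revert p W. induction l as [|d l IH]; simpl; intros p W.
  - subst. apply reach_refl; lra.
  - destruct W as [W0 W]. apply (reach_trans _ _ _ d _ (wlen D d l) (D p d)).
    + auto.
    + apply reach_edge; [auto|]. rewrite SD; lra.
    + lra.
Qed.

(** * Frames: coordinates in which the Yao cones are open quadrants *)

Definition opp (f : pt -> R) : pt -> R := fun p => - f p.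

(* [v] is a nearest point of [V] in the open quadrant (X, Y > 0) at [u], and it is joined to [u]. *)
Definition arc (V : list pt) (G : pt -> pt -> Prop) (D : pt -> pt -> R) (X Y : pt -> R)
  (u v : pt) : Prop :=
  In v V /\ G u v /\ X u < X v /\ Y u < Y v /\
  forall w, In w V -> X u < X w -> Y u < Y w -> D u v <= D u w.

Definition yao_quadrant V G D (X Y : pt -> R) : Prop :=
  forall u w, In u V -> In w V -> X u < X w -> Y u < Y w -> exists v, arc V G D X Y u v.

(* The factor [k] occurs because the rotation is not normalised: it also scales distances. *)
Record frame (V : list pt) (G : pt -> pt -> Prop) (D : pt -> pt -> R) (X Y : pt -> R) : Prop := {
  fr_sym : forall p q, G p q -> G q p;
  fr_D : forall p q, 0 <= D p q;
  fr_metric : exists k, 1 <= k /\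
    forall p q, k * (D p q * D p q) = (X p - X q) * (X p - X q) + (Y p - Y q) * (Y p - Y q);
  fr_X : forall p q, In p V -> In q V -> X p = X q -> p = q;
  fr_Y : forall p q, In p V -> In q V -> Y p = Y q -> p = q;
  fr_pp : yao_quadrant V G D X Y;
  fr_np : yao_quadrant V G D (opp X) Y;
  fr_pn : yao_quadrant V G D X (opp Y);
  fr_nn : yao_quadrant V G D (opp X) (opp Y) }.

Lemma arc_congr V G D X Y X' Y' u v :
  (forall p q, X' p - X' q = X p - X q) -> (forall p q, Y' p - Y' q = Y p - Y q) ->
  arc V G D X Y u v -> arc V G D X' Y' u v.
Proof.
  intros HX HY (Hv & Hg & H1 & H2 & H3).
  pose proof (HX v u); pose proof (HY v u).
  repeat split; try easy; try lra.
  intros w Hw H4 H5. pose proof (HX w u); pose proof (HY w u). apply H3; [easy|lra|lra].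
Qed.

Lemma arc_swap V G D X Y u v : arc V G D X Y u v -> arc V G D Y X u v.
Proof. intros (Hv & Hg & H1 & H2 & H3). repeat split; auto. Qed.

Lemma yao_quadrant_congr V G D X Y X' Y' :
  (forall p q, X' p - X' q = X p - X q) -> (forall p q, Y' p - Y' q = Y p - Y q) ->
  yao_quadrant V G D X Y -> yao_quadrant V G D X' Y'.
Proof.
  intros HX HY H u w Hu Hw H1 H2.
  pose proof (HX w u); pose proof (HY w u).
  destruct (H u w) as [v Hv]; try easy; try lra.
  exists v. eapply arc_congr; eauto.
Qed.

Lemma yao_quadrant_swap V G D X Y : yao_quadrant V G D X Y -> yao_quadrant V G D Y X.
Proof.
  intros H u w Hu Hw H1 H2. destruct (H u w) as [v Hv]; try easy.
  exists v. now apply arc_swap.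
Qed.

Lemma frame_congr V G D X Y X' Y' :
  (forall p q, X' p - X' q = X p - X q) -> (forall p q, Y' p - Y' q = Y p - Y q) ->
  frame V G D X Y -> frame V G D X' Y'.
Proof.
  intros HX HY [S D0 [k [Hk M]] IX IY pp np pn nn].
  assert (OX : forall p q, opp X' p - opp X' q = opp X p - opp X q)
    by (intros p q; unfold opp; pose proof (HX p q); lra).
  assert (OY : forall p q, opp Y' p - opp Y' q = opp Y p - opp Y q)
    by (intros p q; unfold opp; pose proof (HY p q); lra).
  split; try easy; try (eapply yao_quadrant_congr; eassumption).
  - exists k. split; [easy|]. intros p q. rewrite M, HX, HY. reflexivity.
  - intros p q Hp Hq E. apply IX; try easy. pose proof (HX p q); lra.
  - intros p q Hp Hq E. apply IY; try easy. pose proof (HY p q); lra.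
Qed.

Lemma frame_swap V G D X Y : frame V G D X Y -> frame V G D Y X.
Proof.
  intros [S D0 [k [Hk M]] IX IY pp np pn nn].
  split; try easy; try (now apply yao_quadrant_swap).
  exists k. split; [easy|]. intros p q. rewrite M. ring.
Qed.

(** A reflection merely permutes the four quadrant fields, up to differences of coordinates that
    agree. *)
Lemma frame_oppX V G D X Y : frame V G D X Y -> frame V G D (opp X) Y.
Proof.
  intros [S D0 [k [Hk M]] IX IY pp np pn nn].
  split; try easy.
  - exists k. split; [easy|]. intros p q. rewrite M. unfold opp. ring.
  - intros p q Hp Hq E. apply IX; try easy. unfold opp in E; lra.
  - apply (yao_quadrant_congr _ _ _ X Y); try easy. intros; unfold opp; ring.
  - apply (yao_quadrant_congr _ _ _ X (opp Y)); try easy. intros; unfold opp; ring.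
Qed.

Lemma frame_oppY V G D X Y : frame V G D X Y -> frame V G D X (opp Y).
Proof. intros F. apply frame_swap, frame_oppX, frame_swap, F. Qed.

Lemma fr_le V G D X Y p q r s :
  frame V G D X Y -> D p q <= D r s ->
  (X p - X q) * (X p - X q) + (Y p - Y q) * (Y p - Y q)
    <= (X r - X s) * (X r - X s) + (Y r - Y s) * (Y r - Y s).
Proof.
  intros [_ D0 [k [Hk M]] _ _ _ _ _ _] H. rewrite <- !M.
  pose proof (D0 p q). apply Rmult_le_compat_l; [lra|]. nra.
Qed.

Lemma fr_bound V G D X Y p q r :
  frame V G D X Y -> 0 <= r ->
  (X p - X q) * (X p - X q) + (Y p - Y q) * (Y p - Y q) <= r * r -> D p q <= r.
Proof.
  intros [_ D0 [k [Hk M]] _ _ _ _ _ _] Hr H. rewrite <- M in H.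
  pose proof (D0 p q). nra.
Qed.

Lemma fr_Dsym V G D X Y p q : frame V G D X Y -> D p q = D q p.
Proof.
  intros [_ D0 [k [Hk M]] _ _ _ _ _ _].
  pose proof (M p q) as H1; pose proof (M q p) as H2. pose proof (D0 p q); pose proof (D0 q p).
  assert (k * (D p q * D p q) = k * (D q p * D q p)) as E by (rewrite H1, H2; ring).
  apply Rmult_eq_reg_l in E; [|lra]. nra.
Qed.

Lemma frame_reach_sym V G D X Y p q c :
  frame V G D X Y -> reach G D p q c -> reach G D q p c.
Proof.
  intros F. apply reach_sym; [apply (fr_sym _ _ _ _ _ F)|].
  intros u v. apply (fr_Dsym _ _ _ _ _ u v F).
Qed.

Lemma sq_le a b : 0 <= a <= b -> a * a <= b * b.
Proof. intros. apply Rmult_le_compat; lra. Qed.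

Lemma sq_lt a b : 0 <= a < b -> a * a < b * b.
Proof. intros. apply Rmult_le_0_lt_compat; lra. Qed.

Lemma sq_le_inv a b : 0 <= b -> a * a <= b * b -> a <= b.
Proof. intros. apply Rnot_lt_le. intros Hl. pose proof (sq_lt b a). lra. Qed.

(** * Staircases *)

(** The solution of [sqrt 2 * (1 + kappa) = 2 * kappa], the equation at which an overshooting edge
    and the way back just pay for a flat step. *)
Definition kappa : R := 1 + sqrt 2.

Lemma sqrt2_bounds : sqrt 2 * sqrt 2 = 2 /\ 1.414 < sqrt 2 < 1.415.
Proof.
  assert (H : sqrt 2 * sqrt 2 = 2) by (apply sqrt_sqrt; lra).
  pose proof (sqrt_pos 2). split; [easy|]. split; nra.
Qed.

Lemma kappa_bounds : 2.414 < kappa < 2.415.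
Proof. unfold kappa. pose proof sqrt2_bounds. lra. Qed.

(** Without absolute values it telescopes along any chain; it is the L1 distance whenever [q] is to
    the lower right of [p]. *)
Definition l1 (X Y : pt -> R) (p q : pt) : R := (X q - X p) + (Y p - Y q).

(* [z] overshoots [t] along the longer axis of the box spanned by [c] and [t]. *)
Definition overshoot_bound V G (D : pt -> pt -> R) (d : R) : Prop :=
  forall X Y, frame V G D X Y -> forall c t z,
  In c V -> In t V -> D c t = d -> arc V G D X Y c z ->
  Y c < Y t -> Y t - Y c <= X t - X c ->
  (forall w, In w V -> X c < X w < X t -> Y c < Y w < Y t -> False) ->
  X t < X z -> reach G D z t (kappa * l1 X Y t z).

(** If the Yao edge of [f] ends at [f'] or passes it along the longer axis, the step is affordable.
    Otherwise the empty box forces [z] past [f'] along the shorter axis, and that alternative is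
    left to the caller. The overshoot bound is a hypothesis because [overshoot] applies this lemma
    inside its own induction. *)
Lemma link_of_overshoot V G D X Y f f' :
  frame V G D X Y -> overshoot_bound V G D (D f f') ->
  In f V -> In f' V -> X f < X f' -> Y f' < Y f -> Y f - Y f' <= X f' - X f ->
  (forall w, In w V -> X f < X w < X f' -> Y f' < Y w < Y f -> False) ->
  reach G D f f' (kappa * l1 X Y f f') \/
  exists z, arc V G D X (opp Y) f z /\ D f z <= D f f' /\ X z < X f' /\ Y z < Y f'.
Proof.
  intros F OV Hf Hf' HX HY HA HR.
  pose proof kappa_bounds as HK. pose proof sqrt2_bounds as [S1 S2].
  destruct (fr_pn _ _ _ _ _ F f f') as [z Hz]; try easy; [unfold opp; lra|].
  assert (Hz0 := Hz). destruct Hz as (Vz & Gz & Xz & Yz & Nz). unfold opp in Yz.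
  assert (L : D f z <= D f f') by (apply Nz; unfold opp; try easy; lra).
  pose proof (fr_le _ _ _ _ _ _ _ _ _ F L) as L2.
  destruct (classic (z = f')) as [->|Nzf].
  { left. apply reach_edge; [easy|]. unfold l1.
    apply Rle_trans with (X f' - X f + (Y f - Y f')); [|nra].
    apply (fr_bound _ _ _ _ _ _ _ _ F); nra. }
  assert (X z <> X f') by (intros E; apply Nzf, (fr_X _ _ _ _ _ F); easy).
  assert (Y z <> Y f') by (intros E; apply Nzf, (fr_Y _ _ _ _ _ F); easy).
  destruct (Rlt_le_dec (X z) (X f')) as [Hx|Hx].
  { right. exists z. repeat split; try easy.
    destruct (Rlt_le_dec (Y z) (Y f')) as [Hy|Hy]; [easy|].
    exfalso. apply (HR z); try easy; lra. }
  left.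
  assert (Y f' < Y z).
  { apply Rnot_le_lt. intros Hy.
    pose proof (sq_lt (X f' - X f) (X z - X f) ltac:(lra)).
    pose proof (sq_le (Y f - Y f') (Y f - Y z) ltac:(lra)).
    lra. }
  apply (reach_trans _ _ _ z _ (D f z) (kappa * l1 X (opp Y) f' z)).
  - apply reach_edge; [easy|lra].
  - apply (OV X (opp Y) (frame_oppY _ _ _ _ _ F) f); try easy; unfold opp; try lra.
    intros w Hw W1 W2. apply (HR w); try easy; lra.
  - unfold l1, opp.
    set (A := X f' - X f) in *. set (B := Y f - Y f') in *.
    set (g := X z - X f'). set (d := Y z - Y f').
    assert (Hr : (A + g) * (A + g) + (B - d) * (B - d) <= A * A + B * B)
      by (unfold A, B, g, d in *; lra).
    assert (0 <= A /\ 0 < B /\ 0 < g /\ 0 < d < B) as (HA0 & HB0 & Hg0 & Hd0)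
      by (unfold A, B, g, d in *; lra).
    set (r := sqrt ((A + g) * (A + g) + (B - d) * (B - d))).
    assert (r * r = (A + g) * (A + g) + (B - d) * (B - d)) as Hrr
      by (apply sqrt_sqrt; nra).
    assert (0 <= r) as Hr0 by apply sqrt_pos.
    assert (D f z <= r).
    { apply (fr_bound _ _ _ _ _ _ _ _ F); [easy|]. rewrite Hrr. unfold A, B, g, d in *. lra. }
    assert (A + g <= r) by (apply sq_le_inv; [easy|]; pose proof (Rle_0_sqr (B - d)); unfold Rsqr in *; lra).
    assert (r <= sqrt 2 * A).
    { apply sq_le_inv; [nra|]. pose proof (sq_le B A).
      replace (sqrt 2 * A * (sqrt 2 * A)) with ((sqrt 2 * sqrt 2) * (A * A)) by ring.
      rewrite S1. lra. }
    (* The break-even equation of [kappa]. It suffices because [g <= r - A] and [d < B]. *)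
    assert (r * (1 + kappa) <= 2 * kappa * A).
    { unfold kappa. nra. }
    replace (X f' - X f + (Y f - Y f')) with (A + B) by (unfold A, B; ring).
    pose proof (Rmult_le_compat_l kappa (g + d) (r - A + B) ltac:(lra) ltac:(lra)).
    replace (X z - X f') with g by easy. replace (- Y f' - - Y z) with d by (unfold d; ring). lra.
Qed.

(* [Bd f f'] is the alternative left open for a step of the staircase. *)
Lemma staircase V G D X Y (Om : pt -> Prop) (Bd : pt -> pt -> Prop) p0 q0 :
  frame V G D X Y ->
  let mn p := forall w, In w V -> Om w -> X w < X p -> Y w < Y p -> False in
  (forall f f', In f V -> In f' V -> mn f -> mn f' ->
    X p0 <= X f -> Y f <= Y p0 -> X f' <= X q0 -> Y q0 <= Y f' -> X f < X f' -> Y f' < Y f ->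
    (forall w, In w V -> X f < X w < X f' -> Y f' < Y w < Y f -> False) ->
    reach G D f f' (kappa * l1 X Y f f') \/ Bd f f') ->
  In p0 V -> In q0 V -> mn p0 -> mn q0 -> X p0 < X q0 -> Y q0 < Y p0 ->
  reach G D p0 q0 (kappa * l1 X Y p0 q0) \/
  exists g g', Bd g g' /\ X p0 <= X g /\ Y g <= Y p0 /\ X g' <= X q0 /\ Y q0 <= Y g' /\
    In g V /\ In g' V /\ mn g /\ mn g' /\ X g < X g' /\ Y g' < Y g /\
    reach G D g' q0 (kappa * l1 X Y g' q0).
Proof.
  intros F mn Hlink Hp0 Hq0 Mp0 Mq0 HX0 HY0.
  pose proof kappa_bounds as HK.
  enough (H : forall f f', In f V -> In f' V -> mn f -> mn f' ->
    X p0 <= X f -> Y f <= Y p0 -> X f' <= X q0 -> Y q0 <= Y f' -> X f < X f' -> Y f' < Y f ->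
    reach G D f f' (kappa * l1 X Y f f') \/
    exists g g', Bd g g' /\ X f <= X g /\ Y g <= Y f /\ X g' <= X f' /\ Y f' <= Y g' /\
    In g V /\ In g' V /\ mn g /\ mn g' /\ X g < X g' /\ Y g' < Y g /\
    reach G D g' f' (kappa * l1 X Y g' f')) by (apply H; auto; lra).
  intros f f' Hf Hf'. revert f f' Hf Hf'.
  apply (pair_real_ind V (fun f f' => X f' - X f) (fun f f' => mn f -> mn f' ->
    X p0 <= X f -> Y f <= Y p0 -> X f' <= X q0 -> Y q0 <= Y f' -> X f < X f' -> Y f' < Y f ->
    reach G D f f' (kappa * l1 X Y f f') \/
    exists g g', Bd g g' /\ X f <= X g /\ Y g <= Y f /\ X g' <= X f' /\ Y f' <= Y g' /\
    In g V /\ In g' V /\ mn g /\ mn g' /\ X g < X g' /\ Y g' < Y g /\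
    reach G D g' f' (kappa * l1 X Y g' f'))).
  intros f f' Hf Hf' IH Mf Mf' B1 B2 B3 B4 HX HY.
  destruct (classic (exists w, In w V /\ (X f < X w < X f' /\ Y f' < Y w < Y f))) as [Hw|Hw].
  (* A point of the box with least [X + Y] is minimal in the whole region: a point of [Om] to its
     lower left is in the box with a smaller sum, or contradicts minimality of [f] or of [f']. *)
  - destruct (list_argmin V (fun w => X w + Y w) _ Hw) as [p [Hp [[P1 P2] Pmin]]].
    assert (Mp : mn p).
    { intros w Vw Ow W1 W2.
      assert (X w <> X f) by (intros E; apply (fr_X _ _ _ _ _ F) in E; try easy; subst; lra).
      assert (Y w <> Y f') by (intros E; apply (fr_Y _ _ _ _ _ F) in E; try easy; subst; lra).
      destruct (Rlt_le_dec (X w) (X f)); [apply (Mf w); auto; lra|].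
      destruct (Rlt_le_dec (Y w) (Y f')); [apply (Mf' w); auto; lra|].
      assert (X p + Y p <= X w + Y w) by (apply Pmin; [easy|lra]). lra. }
    (* The right half comes first, so the reported pair is the last open step and everything after
       [g'] is already joined. *)
    destruct (IH p f') as [R1|(g & g' & R1)]; try easy; try lra.
    2:{ right. exists g, g'. intuition lra. }
    destruct (IH f p) as [R2|(g & g' & R2)]; try easy; try lra.
    + left. eapply reach_trans; [exact R2|exact R1|]. unfold l1. lra.
    + right. exists g, g'.
      destruct R2 as (r1 & r2 & r3 & r4 & r5 & r6 & r7 & r8 & r9 & r10 & r11 & r12).
      repeat (split; [auto; lra|]).
      eapply reach_trans; [exact r12|exact R1|]. unfold l1. lra.
  - assert (HR : forall w, In w V -> X f < X w < X f' -> Y f' < Y w < Y f -> False)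
      by (intros w W1 W2 W3; apply Hw; eauto).
    destruct (Hlink f f') as [R|R]; auto.
    right. exists f, f'. repeat (split; [auto; lra|]).
    apply reach_refl. unfold l1. lra.
Qed.

(** * Edges that overshoot their target *)

Lemma fr_lt V G D X Y p q r s :
  frame V G D X Y ->
  (X p - X q) * (X p - X q) + (Y p - Y q) * (Y p - Y q)
    < (X r - X s) * (X r - X s) + (Y r - Y s) * (Y r - Y s) -> D p q < D r s.
Proof.
  intros F H. apply Rnot_le_lt. intros L.
  pose proof (fr_le _ _ _ _ _ _ _ _ _ F L). lra.
Qed.

(** No point of the quadrant of [c] is nearer to [c] than [z]. This makes the staircase from [t] to
    [z] so narrow that its steps are shorter than [D c t], and an escaping Yao edge would be longer
    than its step. The recursive calls use reflected or exchanged axes, so the induction on [D c t]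
    quantifies over frames. *)
Lemma overshoot V G D X Y c t z :
  frame V G D X Y -> In c V -> In t V -> arc V G D X Y c z ->
  Y c < Y t -> Y t - Y c <= X t - X c ->
  (forall w, In w V -> X c < X w < X t -> Y c < Y w < Y t -> False) ->
  X t < X z -> reach G D z t (kappa * l1 X Y t z).
Proof.
  intros F Hc Ht. revert X Y z F. revert c t Hc Ht.
  apply (pair_real_ind V D (fun c t => forall X Y z, frame V G D X Y -> arc V G D X Y c z ->
    Y c < Y t -> Y t - Y c <= X t - X c ->
    (forall w, In w V -> X c < X w < X t -> Y c < Y w < Y t -> False) ->
    X t < X z -> reach G D z t (kappa * l1 X Y t z))).
  intros c t Hc Ht IH X Y z F Az HY HXY HR HX.
  assert (OV : forall f f', In f V -> In f' V -> D f f' < D c t -> overshoot_bound V G D (D f f')).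
  { intros f f' Hf Hf' Hlt X' Y' F' c' t' z' Hc' Ht' E A' R1 R2 R3 R4.
    apply (IH c' t'); try easy. lra. }
  clear IH. destruct Az as (Vz & Gz & Xz & Yz & Nz).
  assert (Lt : D c z <= D c t) by (apply Nz; try easy; lra).
  pose proof (fr_le _ _ _ _ _ _ _ _ _ F Lt) as Lt2.
  assert (YZ : Y z < Y t).
  { apply Rnot_le_lt. intros Hy.
    pose proof (sq_lt (X t - X c) (X z - X c) ltac:(lra)).
    pose proof (sq_le (Y t - Y c) (Y z - Y c) ltac:(lra)). lra. }
  apply (frame_reach_sym _ _ _ _ _ _ _ _ F).
  destruct (staircase V G D X Y (fun w => X c < X w /\ Y c < Y w) (fun _ _ => False) t z F)
    as [R|(g & g' & [] & _)]; try easy.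
  2:{ intros w Vw [O1 O2] W1 W2. apply (HR w); try easy; lra. }
  2:{ intros w Vw [O1 O2] W1 W2.
      assert (L : D c z <= D c w) by (apply Nz; easy).
      pose proof (fr_le _ _ _ _ _ _ _ _ _ F L).
      pose proof (sq_lt (X w - X c) (X z - X c) ltac:(lra)).
      pose proof (sq_lt (Y w - Y c) (Y z - Y c) ltac:(lra)). lra. }
  intros f f' Hf Hf' Mf Mf' B1 B2 B3 B4 FX FY FR. left.
  assert (L : D c z <= D c f) by (apply Nz; try easy; lra).
  pose proof (fr_le _ _ _ _ _ _ _ _ _ F L) as L2.
  (* [D c z <= D c f] bounds twice [X z - X f] times [X f - X c] by the square of [Y f - Y c], and
     [X f - X c >= Y f - Y c] since [f] is neither left of nor above [t]. *)
  assert (Ha : 2 * (X z - X f) < Y f - Y c).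
  { apply Rnot_le_lt. intros Ha.
    assert ((X z - X f) * (X f - X c) >= (X z - X f) * (Y f - Y c)) by nra.
    nra. }
  assert (D f f' < D c t) as Hlt.
  { apply (fr_lt _ _ _ _ _ _ _ _ _ F).
    pose proof (sq_le (2 * (X f' - X f)) (Y t - Y c) ltac:(lra)).
    pose proof (sq_lt (Y f - Y f') (Y t - Y c) ltac:(lra)).
    pose proof (sq_le (Y t - Y c) (X t - X c) ltac:(lra)).
    pose proof (sq_lt 0 (Y t - Y c) ltac:(lra)). lra. }
  destruct (Rle_lt_dec (Y f - Y f') (X f' - X f)) as [Hflat|Htall].
  - destruct (link_of_overshoot V G D X Y f f' F (OV f f' Hf Hf' Hlt))
      as [R|(z2 & A2 & D2 & X2 & Y2)]; try easy.
    (* Above [c], [z2] contradicts minimality of [f']. Otherwise the edge drops by at least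
       [Y f - Y c], more than [2 * (X f' - X f)], while a flat step is at most
       [sqrt 2 * (X f' - X f)] long. *)
    exfalso. destruct A2 as (V2 & _ & X2' & _).
    destruct (Rlt_le_dec (Y c) (Y z2)) as [Hy|Hy].
    + apply (Mf' z2); try easy; lra.
    + pose proof (fr_le _ _ _ _ _ _ _ _ _ F D2).
      pose proof (sq_le (Y f - Y c) (Y f - Y z2) ltac:(lra)).
      pose proof (sq_le (2 * (X f' - X f)) (Y f - Y c) ltac:(lra)).
      pose proof (sq_le (Y f - Y f') (X f' - X f) ltac:(lra)).
      pose proof (sq_lt 0 (Y f - Y c) ltac:(lra)).
      pose proof (Rle_0_sqr (X f - X z2)). unfold Rsqr in *. lra.
  - rewrite (fr_Dsym _ _ _ _ _ f f' F) in Hlt.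
    destruct (link_of_overshoot V G D Y X f' f (frame_swap _ _ _ _ _ F) (OV f' f Hf' Hf Hlt))
      as [R|(z2 & A2 & D2 & X2 & Y2)]; try easy; try lra.
    + intros w Vw W1 W2. apply (FR w); easy.
    + apply (frame_reach_sym _ _ _ _ _ _ _ _ F). eapply reach_le; [exact R|].
      unfold l1. lra.
    (* An edge from [f'] back to the abscissa of [c] is too wide: the step is lower than
       [X f - X c], so its length is below [X f' - X c]. *)
    + exfalso. destruct A2 as (V2 & _ & X2' & _).
      destruct (Rlt_le_dec (X c) (X z2)) as [Hx|Hx].
      * apply (Mf z2); try easy; lra.
      * pose proof (fr_le _ _ _ _ _ _ _ _ _ F D2).
        pose proof (sq_le (X f' - X c) (X f' - X z2) ltac:(lra)).
        pose proof (sq_lt (Y f - Y f') (X f - X c) ltac:(lra)).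
        pose proof (Rmult_le_pos (X f - X c) (X f' - X f) ltac:(lra) ltac:(lra)).
        pose proof (Rle_0_sqr (Y f' - Y z2)). unfold Rsqr in *. lra.
Qed.

Lemma link V G D X Y f f' :
  frame V G D X Y ->
  In f V -> In f' V -> X f < X f' -> Y f' < Y f -> Y f - Y f' <= X f' - X f ->
  (forall w, In w V -> X f < X w < X f' -> Y f' < Y w < Y f -> False) ->
  reach G D f f' (kappa * l1 X Y f f') \/
  exists z, arc V G D X (opp Y) f z /\ D f z <= D f f' /\ X z < X f' /\ Y z < Y f'.
Proof.
  intros F. apply link_of_overshoot; [easy|].
  intros X' Y' F' c t z Hc Ht _. now apply overshoot.
Qed.

(** Used when a Yao edge of [g] escapes to the left beyond [a]. The staircase from [a] to [z]
    consists of maximal points, hence both axes are reversed; the empty boxes between [a] and [g]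
    and between [z] and [g] keep it to the lower left of [g]. *)
Lemma left_travel V G D X Y g z a :
  frame V G D X Y -> In g V -> In a V -> arc V G D (opp X) Y g z ->
  X z < X a -> X a < X g -> Y a < Y g ->
  (forall w, In w V -> X a < X w < X g -> Y a < Y w < Y g -> False) ->
  Y z - Y a <= X g - X a ->
  reach G D z a (kappa * l1 X Y z a).
Proof.
  intros F Hg Ha (Vz & Gz & Xz & Yz & Nz) XZ XA YA HR HQ. unfold opp in Xz.
  assert (near : forall w, In w V -> X z < X w -> X w < X g -> Y g < Y w -> Y w <= Y z -> False).
  { intros w Vw W1 W2 W3 W4.
    assert (L : D g z <= D g w) by (apply Nz; unfold opp; try easy; lra).
    pose proof (fr_le _ _ _ _ _ _ _ _ _ F L).
    pose proof (sq_lt (X g - X w) (X g - X z) ltac:(lra)).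
    pose proof (sq_le (Y w - Y g) (Y z - Y g) ltac:(lra)). lra. }
  pose proof (frame_oppY _ _ _ _ _ (frame_oppX _ _ _ _ _ F)) as Fo.
  apply (frame_reach_sym _ _ _ _ _ _ _ _ F).
  replace (l1 X Y z a) with (l1 (opp X) (opp Y) a z) by (unfold l1, opp; ring).
  destruct (staircase V G D (opp X) (opp Y) (fun w => X w < X g /\ Y w <= Y z)
    (fun _ _ => False) a z Fo) as [R|(? & ? & [] & _)]; unfold opp in *; try easy; try lra.
  2:{ intros w Vw [O1 O2] W1 W2.
      destruct (Rlt_le_dec (Y w) (Y g)) as [H|[H|H]].
      - apply (HR w); try easy; lra.
      - apply (near w); try easy; lra.
      - symmetry in H. apply (fr_Y _ _ _ _ _ F) in H; try easy. subst; lra. }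
  2:{ intros w Vw [O1 O2] W1 W2. lra. }
  intros f f' Hf Hf' Mf Mf' B1 B2 B3 B4 FX FY FR. left.
  assert (Yfg : Y f <= Y g).
  { apply Rnot_lt_le. intros H. apply (near f); try easy; lra. }
  destruct (Rle_lt_dec (Y f' - Y f) (X f - X f')) as [Hflat|Htall].
  - destruct (link V G D (opp X) (opp Y) f f' Fo) as [R|(z2 & A2 & D2 & X2 & Y2)];
      unfold opp in *; try easy; try lra.
    exfalso. destruct A2 as (V2 & _ & X2' & Y2' & _).
    destruct (Rle_lt_dec (Y z2) (Y z)) as [Hy|Hy].
    + apply (Mf' z2); try easy; lra.
    (* Moving from [f] right and up to [g] adds strictly more to the squared distance from [z] than
       to that from [z2], which lies right of and above [z]. As [z2] is no farther from [f] than [z]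
       is, it would be strictly nearer to [g]. *)
    + assert (L : D g z <= D g z2) by (apply Nz; try easy; lra).
      pose proof (fr_le _ _ _ _ _ _ _ _ _ F L).
      pose proof (fr_le _ _ _ _ _ _ _ _ _ F D2).
      pose proof (sq_le (X f - X f') (X f - X z) ltac:(lra)).
      pose proof (sq_le (Y f' - Y f) (Y z - Y f) ltac:(lra)).
      pose proof (Rmult_lt_0_compat (X g - X f) (X z2 - X z) ltac:(lra) ltac:(lra)).
      pose proof (Rmult_le_pos (Y g - Y f) (Y z2 - Y z) ltac:(lra) ltac:(lra)).
      lra.
  - pose proof (frame_swap _ _ _ _ _ Fo) as Fs.
    destruct (link V G D (opp Y) (opp X) f' f Fs) as [R|(z2 & A2 & D2 & X2 & Y2)];
      unfold opp in *; try easy; try lra.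
    + intros w Vw W1 W2. apply (FR w); easy.
    + apply (frame_reach_sym _ _ _ _ _ _ _ _ F). eapply reach_le; [exact R|].
      unfold l1. lra.
    + exfalso. destruct A2 as (V2 & _ & X2' & Y2' & _).
      destruct (Rlt_le_dec (X z2) (X g)) as [Hx|Hx].
      * apply (Mf z2); try easy; lra.
      * pose proof (fr_le _ _ _ _ _ _ _ _ _ F D2).
        pose proof (sq_le (X g - X f') (X z2 - X f') ltac:(lra)).
        pose proof (sq_le (X f - X f') (X a - X f') ltac:(lra)).
        pose proof (sq_le (Y f' - Y f) (X g - X a) ltac:(lra)).
        pose proof (Rmult_lt_0_compat (X g - X a) (X a - X f') ltac:(lra) ltac:(lra)).
        pose proof (Rle_0_sqr (Y f' - Y z2)). unfold Rsqr in *. lra.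
Qed.

(** * The empty unit square *)

(* [x], [y] are the coordinates in which the empty square is the unit square; [X], [Y] order the
   points as [x], [y] do, except that ties are broken. *)
Record setting V G (D : pt -> pt -> R) (e : R) (x y X Y : pt -> R) (a b : pt) : Prop := {
  st_frame : frame V G D X Y;
  st_X : forall p, X p = x p + e * y p;
  st_Y : forall p, Y p = y p - e * x p;
  st_D : forall p q, D p q * D p q = (x p - x q) * (x p - x q) + (y p - y q) * (y p - y q);
  st_e : -1/100 <= e <= 1/100;
  st_wx : forall p q, In p V -> In q V -> X p < X q -> x p <= x q;
  st_wy : forall p q, In p V -> In q V -> Y p < Y q -> y p <= y q;
  st_a : In a V; st_b : In b V;
  st_xa : x a = 0; st_xb : x b = 1;
  st_ya : 0 <= y a <= 1; st_yb : 0 <= y b <= 1;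
  st_ab : Y a < Y b;
  st_flat : Y b - Y a <= X b - X a;
  st_box : forall w, In w V -> X a < X w < X b ->
    (1 <= y w /\ Y a < Y w /\ Y b < Y w) \/ (y w <= 0 /\ Y w < Y a /\ Y w < Y b) }.

Definition top (X y : pt -> R) (a b w : pt) : Prop := X a < X w < X b /\ 1 <= y w.

Definition minimal (V : list pt) (X Y : pt -> R) (Om : pt -> Prop) (p : pt) : Prop :=
  forall w, In w V -> Om w -> X w < X p -> Y w < Y p -> False.

(** The numbers exceed [sqrt 2] and [1.01 * sqrt 2], where 1.01 absorbs the tilt of the axes. *)
Lemma setting_size V G D e x y X Y a b :
  setting V G D e x y X Y a b ->
  0.99 <= X b - X a <= 1.01 /\ D a b <= 1.415 /\
  forall v, D a v <= D a b -> Y v - Y a <= 1.43 /\ X v - X a <= 1.43.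
Proof.
  intros S. pose proof (st_frame _ _ _ _ _ _ _ _ _ _ S) as F.
  pose proof (st_X _ _ _ _ _ _ _ _ _ _ S) as EX.
  pose proof (st_Y _ _ _ _ _ _ _ _ _ _ S) as EY.
  pose proof (st_D _ _ _ _ _ _ _ _ _ _ S) as ED.
  pose proof (st_e _ _ _ _ _ _ _ _ _ _ S) as He.
  pose proof (st_xa _ _ _ _ _ _ _ _ _ _ S) as xa.
  pose proof (st_xb _ _ _ _ _ _ _ _ _ _ S) as xb.
  pose proof (st_ya _ _ _ _ _ _ _ _ _ _ S) as ya.
  pose proof (st_yb _ _ _ _ _ _ _ _ _ _ S) as yb.
  pose proof (st_ab _ _ _ _ _ _ _ _ _ _ S) as yab.
  pose proof (st_flat _ _ _ _ _ _ _ _ _ _ S) as fl.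
  assert (H1 : 0.99 <= X b - X a <= 1.01) by (rewrite !EX, xa, xb; split; nra).
  split; [easy|]. split.
  - apply sq_le_inv; [lra|]. rewrite ED, xa, xb. nra.
  - intros v L. pose proof (fr_le _ _ _ _ _ _ _ _ _ F L) as L2.
    pose proof (Rle_0_sqr (X a - X v)). pose proof (Rle_0_sqr (Y a - Y v)). unfold Rsqr in *.
    pose proof (sq_le (X b - X a) 1.01 ltac:(lra)).
    pose proof (sq_le (Y b - Y a) (X b - X a) ltac:(lra)).
    split; apply sq_le_inv; lra.
Qed.

(** The drop is at least [y f], while the step is at most 1 wide and [y f - 1] high. This leaves
    only [y f = 1] and a step across the full width; there the strict orders in [X] and [Y] are
    incompatible for either sign of [e]. *)
Lemma no_drop V G D e x y X Y a b f f' z :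
  setting V G D e x y X Y a b ->
  In f V -> In f' V -> top X y a b f -> top X y a b f' ->
  Y f' < Y f -> y z <= 0 -> D f z <= D f f' -> False.
Proof.
  intros S Hf Hf' [Tf1 Tf2] [Tf1' Tf2'] FY ZY L.
  pose proof (st_X _ _ _ _ _ _ _ _ _ _ S) as EX.
  pose proof (st_xa _ _ _ _ _ _ _ _ _ _ S) as xa.
  pose proof (st_xb _ _ _ _ _ _ _ _ _ _ S) as xb.
  pose proof (st_ya _ _ _ _ _ _ _ _ _ _ S) as ya.
  pose proof (st_yb _ _ _ _ _ _ _ _ _ _ S) as yb.
  pose proof (st_a _ _ _ _ _ _ _ _ _ _ S) as Ha.
  pose proof (st_b _ _ _ _ _ _ _ _ _ _ S) as Hb.
  pose proof (st_wx _ _ _ _ _ _ _ _ _ _ S) as wx.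
  pose proof (wx a f Ha Hf ltac:(lra)). pose proof (wx f b Hf Hb ltac:(lra)).
  pose proof (wx a f' Ha Hf' ltac:(lra)). pose proof (wx f' b Hf' Hb ltac:(lra)).
  pose proof (st_wy _ _ _ _ _ _ _ _ _ _ S f' f Hf' Hf FY).
  pose proof (fr_D _ _ _ _ _ (st_frame _ _ _ _ _ _ _ _ _ _ S) f z).
  assert (L2 : D f z * D f z <= D f f' * D f f') by (apply sq_le; lra).
  rewrite !(st_D _ _ _ _ _ _ _ _ _ _ S) in L2.
  pose proof (sq_le (y f - y f') (y f - 1) ltac:(lra)).
  pose proof (sq_le (y f) (y f - y z) ltac:(lra)).
  pose proof (Rle_0_sqr (x f - x z)). unfold Rsqr in *.
  assert (Hw : (x f - x f') * (x f - x f') <= 1) by nra.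
  assert (y f = 1) as yf by lra.
  assert (y f' = 1) as yf' by lra.
  assert (Hw' : (x f - x f') * (x f - x f') >= 1) by nra.
  rewrite !EX, yf, yf', xa, xb in *.
  destruct (Rle_lt_dec (x f) (x f')) as [Hx|Hx].
  - assert (x f = 0) as xf by nra. assert (x f' = 1) as xf' by nra.
    rewrite xf, xf' in *. destruct (Rle_lt_dec 0 e); nra.
  - assert (x f = 1) as xf by nra. assert (x f' = 0) as xf' by nra.
    rewrite xf, xf' in *. destruct (Rle_lt_dec 0 e); nra.
Qed.

(** Coordinates are relative to [a]: [g'] is at [(Xg, Yq)], [v] has height [V], the step from [g] to
    [g'] has sides [A], [B], and the edge of [g'] ends [o] to the left of [a] and [j] above [g'].
    Being lower than [v] by [u] but no nearer to [a], [g'] has squared abscissa at least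
    [u * u + 2 * (u * Yq)]. The edge is longer than that abscissa but no longer than the step, so
    little is left for [j]. *)
Lemma wide_exit Xg Yq V A B o j :
  0 < Xg -> 0 < Yq -> 0 < V -> 0 < A < B -> B <= V - Yq -> 0 < o -> 0 < j ->
  V * V <= Xg * Xg + Yq * Yq ->
  (Xg + o) * (Xg + o) + j * j <= A * A + B * B ->
  Yq + j <= V - Yq /\ V - Yq <= Xg /\ 2 * Yq <= V - Yq /\
  (Xg + o) * (Xg + o) + j * j <= 2 * ((V - Yq) * (V - Yq)).
Proof.
  intros HX HY HV HA HB Ho Hj H1 H2.
  set (u := V - Yq) in *.
  assert (V = u + Yq) as EV by (unfold u; ring).
  pose proof (sq_lt A B ltac:(lra)). pose proof (sq_le B u ltac:(lra)).
  assert (Hu : Xg * Xg >= u * u + 2 * (u * Yq)) by (rewrite EV in H1; lra).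
  pose proof (Rmult_lt_0_compat u Yq ltac:(lra) HY).
  assert (HXu : u <= Xg) by (apply sq_le_inv; lra).
  pose proof (Rmult_lt_0_compat Xg o HX Ho). pose proof (Rmult_lt_0_compat o o Ho Ho).
  pose proof (Rmult_lt_0_compat j j Hj Hj).
  assert (2 * Yq <= u).
  { apply Rnot_lt_le. intros Hc. pose proof (Rmult_lt_0_compat u (2 * Yq - u) ltac:(lra) ltac:(lra)). lra. }
  split; [|split; [easy|split; [easy|lra]]].
  assert (j <= u - Yq) by (apply sq_le_inv; [lra|]; pose proof (Rmult_lt_0_compat Yq Yq HY HY); lra).
  lra.
Qed.

(** Flat steps from [v] to [p] cannot fail, by minimality and [no_drop]. A tall step fails only if
    the Yao edge of its lower end escapes to the left of [a]; a detour through the end of that edge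
    then replaces the path up to the last failing step. The value 5.5 exceeds both
    [1.415 + kappa * 1.43] and [(1.4143 + kappa * 0.9143) * 1.43]. *)
Lemma reach_top V G D e x y X Y a b v p :
  setting V G D e x y X Y a b ->
  arc V G D X Y a v -> X v < X b ->
  In p V -> top X y a b p -> X v <= X p -> minimal V X Y (top X y a b) p ->
  reach G D a p (5.5 + kappa * (X p - X a)).
Proof.
  intros S Av Xvb Hp Tp Xvp Mp.
  destruct (setting_size _ _ _ _ _ _ _ _ _ _ S) as (SX & SD & SY).
  pose proof (st_frame _ _ _ _ _ _ _ _ _ _ S) as F.
  pose proof (st_box _ _ _ _ _ _ _ _ _ _ S) as box.
  pose proof (st_a _ _ _ _ _ _ _ _ _ _ S) as Ha.
  pose proof (st_b _ _ _ _ _ _ _ _ _ _ S) as Hb.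
  pose proof (st_ab _ _ _ _ _ _ _ _ _ _ S) as Yab.
  assert (topY : forall w, In w V -> top X y a b w -> Y a < Y w /\ Y b < Y w).
  { intros w Vw [W1 W2]. destruct (box w Vw W1) as [H|H]; [tauto|lra]. }
  assert (topI : forall w, In w V -> X a < X w < X b -> Y a < Y w -> top X y a b w).
  { intros w Vw W1 W2. destruct (box w Vw W1) as [H|H]; [split; tauto|lra]. }
  assert (Av' := Av). destruct Av' as (Vv & Gv & Xv & Yv & Nv).
  assert (Lab : D a v <= D a b) by (apply Nv; try easy; lra).
  destruct (SY v Lab) as [SYv _].
  pose proof kappa_bounds as HK.
  pose proof (Rmult_le_pos kappa (X p - X a)).
  destruct (classic (v = p)) as [<-|Nvp].
  { apply reach_edge; [easy|]. lra. }
  assert (X v <> X p) by (intros E; apply Nvp, (fr_X _ _ _ _ _ F); easy).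
  assert (Y v <> Y p) by (intros E; apply Nvp, (fr_Y _ _ _ _ _ F); easy).
  assert (Tv : top X y a b v) by (apply topI; try easy; lra).
  assert (Y p < Y v).
  { apply Rnot_le_lt. intros Hy. apply (Mp v); try easy; lra. }
  destruct (topY p Hp Tp) as [Yap Ybp].
  assert (Mv : minimal V X Y (top X y a b) v).
  { intros w Vw Ow W1 W2. destruct (topY w Vw Ow). destruct Ow as [O1 O2].
    assert (L : D a v <= D a w) by (apply Nv; easy).
    pose proof (fr_le _ _ _ _ _ _ _ _ _ F L).
    pose proof (sq_lt (X w - X a) (X v - X a) ltac:(lra)).
    pose proof (sq_lt (Y w - Y a) (Y v - Y a) ltac:(lra)). lra. }
  set (Bd := fun f f' => X f' - X f < Y f - Y f' /\
    exists z, arc V G D (opp X) Y f' z /\ D f' z <= D f' f /\ X z < X a).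
  destruct (staircase V G D X Y (top X y a b) Bd v p F) as [R|R]; try easy; try lra.
  - intros f f' Hf Hf' Mf Mf' B1 B2 B3 B4 FX FY FR.
    destruct Tp as [Tp1 Tp2].
    assert (Tf : top X y a b f) by (apply topI; try easy; lra).
    assert (Tf' : top X y a b f') by (apply topI; try easy; lra).
    destruct (Rle_lt_dec (Y f - Y f') (X f' - X f)) as [Hflat|Htall].
    + left. destruct (link V G D X Y f f' F) as [R|(z2 & A2 & D2 & X2 & Y2)]; try easy.
      exfalso. destruct A2 as (V2 & _ & X2' & _).
      destruct (box z2 V2) as [Bx|Bx]; [lra| |].
      * apply (Mf' z2); try easy. split; [lra|tauto].
      * apply (no_drop _ _ _ _ _ _ _ _ _ _ f f' z2 S); try easy; tauto.
    + destruct (link V G D Y X f' f (frame_swap _ _ _ _ _ F))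
        as [R|(z2 & A2 & D2 & X2 & Y2)]; try easy; try lra.
      * intros w Vw W1 W2. apply (FR w); easy.
      * left. apply (frame_reach_sym _ _ _ _ _ _ _ _ F). eapply reach_le; [exact R|].
        unfold l1. lra.
      * right. split; [easy|]. exists z2.
        split; [now apply arc_swap|]. split; [easy|].
        destruct A2 as (V2 & _ & X2' & Y2' & _).
        apply Rnot_le_lt. intros [Hx|Hx].
        -- apply (Mf z2); try easy; try lra. apply topI; try easy; try lra.
        -- apply (fr_X _ _ _ _ _ F) in Hx; try easy. subst z2.
           destruct (topY f' Hf' Tf'). lra.
  - apply (reach_trans _ _ _ v _ (D a v) (kappa * l1 X Y v p)); try easy.
    + now apply reach_edge; [|lra].
    + unfold l1.
      pose proof (Rmult_le_compat_l kappa (X p - X v + (Y v - Y p)) (X p - X a + 1.43) ltac:(lra) ltac:(lra)).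
      lra.
  - destruct R as (g & g' & [Tall (z & Az & Dz & Zx)] & B1 & B2 & B3 & B4 & Hg & Hg' & Mg & Mg'
      & GX & GY & R).
    destruct Tp as [Tp1 Tp2].
    assert (Tg' : top X y a b g') by (apply topI; try easy; lra).
    destruct Tg' as [Tg1 Tg2].
    assert (L : D a v <= D a g') by (apply Nv; try easy; lra).
    pose proof (fr_le _ _ _ _ _ _ _ _ _ F L) as L2.
    pose proof (fr_le _ _ _ _ _ _ _ _ _ F Dz) as Dz2.
    assert (Az' := Az). destruct Az' as (Vz & Gz & Xz & Yz & _). unfold opp in Xz.
    destruct (wide_exit (X g' - X a) (Y g' - Y a) (Y v - Y a) (X g' - X g) (Y g - Y g')
      (X a - X z) (Y z - Y g')) as (W1 & W2 & W3 & W4); try lra.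
    { pose proof (Rle_0_sqr (X v - X a)). unfold Rsqr in *. lra. }
    assert (LT : reach G D z a (kappa * l1 X Y z a)).
    { apply (left_travel V G D X Y g' z a); try easy; try lra.
      intros w Vw U1 U2. apply (Mg' w); try easy; try lra. apply topI; try easy; lra. }
    set (u := Y v - Y a - (Y g' - Y a)) in *.
    assert (DZ : D g' z <= 1.4143 * u).
    { apply (fr_bound _ _ _ _ _ _ _ _ F); [lra|].
      pose proof (Rle_0_sqr u). unfold Rsqr in *. lra. }
    assert (X g' - X z <= 1.4143 * u).
    { apply sq_le_inv; [lra|].
      pose proof (Rle_0_sqr (Y z - Y g')). pose proof (Rle_0_sqr u). unfold Rsqr in *. lra. }
    apply (reach_trans _ _ _ z _ (kappa * l1 X Y z a) (D g' z + kappa * l1 X Y g' p)).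
    + apply (frame_reach_sym _ _ _ _ _ _ _ _ F). exact LT.
    + apply (reach_trans _ _ _ g' _ (D g' z) (kappa * l1 X Y g' p)); [|exact R|lra].
      apply reach_edge; [now apply (fr_sym _ _ _ _ _ F)|]. rewrite (fr_Dsym _ _ _ _ _ z g' F). lra.
    (* [0.9143 = 1.4143 - 2 + 1 + 1/2]: [X g' - X z] is at most [1.4143 * u], the abscissa of [g']
       relative to [a], at least [u], is saved twice, and the two vertical parts are at most [u] and
       [u / 2]. *)
    + assert (Hl : l1 X Y z a + l1 X Y g' p <= (X p - X a) + 0.9143 * u)
        by (unfold l1, u in *; lra).
      assert (u <= 1.43) by (unfold u; lra).
      pose proof (Rmult_le_compat_l kappa _ _ ltac:(lra) Hl).
      assert (kappa * u <= 2.415 * 1.43) by (apply Rmult_le_compat; lra).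
      lra.
Qed.

Lemma first_top_minimal V G D e x y X Y a b v :
  setting V G D e x y X Y a b -> arc V G D X Y a v ->
  minimal V X Y (top X y a b) v.
Proof.
  intros S (Vv & Gv & Xv & Yv & Nv) w Vw [O1 O2] W1 W2.
  destruct (st_box _ _ _ _ _ _ _ _ _ _ S w Vw O1) as [H|H]; [|lra].
  assert (L : D a v <= D a w) by (apply Nv; try easy; lra).
  pose proof (fr_le _ _ _ _ _ _ _ _ _ (st_frame _ _ _ _ _ _ _ _ _ _ S) L).
  pose proof (sq_lt (X w - X a) (X v - X a) ltac:(lra)).
  pose proof (sq_lt (Y w - Y a) (Y v - Y a) ltac:(lra)). lra.
Qed.

(* [u] lies below the square and its edge to [c] crosses the square upwards. *)
Lemma reach_right V G D e x y X Y a b u c p :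
  setting V G D e x y X Y a b ->
  In u V -> X a < X u < X b -> y u <= 0 -> Y a - Y u <= X u - X a ->
  arc V G D (opp X) Y u c -> D u c <= D u a -> X a < X c -> 1 <= y c ->
  In p V -> top X y a b p -> X p <= X c -> Y p <= Y c ->
  (forall w, In w V -> top X y a b w -> X w < X u -> X p < X w -> Y w < Y p -> False) ->
  reach G D p c (kappa * ((X c - X p) + 0.45)).
Proof.
  intros S Hu Xu yu Hfl Ac Dc Xac yc Hp Tp Xpc Ypc Mp.
  destruct (setting_size _ _ _ _ _ _ _ _ _ _ S) as (SX & SD & _).
  pose proof (st_frame _ _ _ _ _ _ _ _ _ _ S) as F.
  pose proof (st_box _ _ _ _ _ _ _ _ _ _ S) as box.
  pose proof (st_a _ _ _ _ _ _ _ _ _ _ S) as Ha.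
  pose proof (st_b _ _ _ _ _ _ _ _ _ _ S) as Hb.
  assert (Ac' := Ac). destruct Ac' as (Vc & Gc & Xc & Yc & Nc). unfold opp in Xc.
  pose proof kappa_bounds as HK.
  assert (Tc : top X y a b c) by (split; [lra|easy]).
  assert (topY : forall w, In w V -> top X y a b w -> Y a < Y w /\ 0.99 <= Y w - Y u).
  { intros w Vw [W1 W2]. destruct (box w Vw W1) as [H|H]; [|lra]. split; [tauto|].
    rewrite !(st_Y _ _ _ _ _ _ _ _ _ _ S).
    pose proof (st_wx _ _ _ _ _ _ _ _ _ _ S a w Ha Vw ltac:(lra)) as h1.
    pose proof (st_wx _ _ _ _ _ _ _ _ _ _ S w b Vw Hb ltac:(lra)) as h2.
    pose proof (st_wx _ _ _ _ _ _ _ _ _ _ S a u Ha Hu ltac:(lra)) as h3.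
    pose proof (st_wx _ _ _ _ _ _ _ _ _ _ S u b Hu Hb ltac:(lra)) as h4.
    rewrite (st_xa _ _ _ _ _ _ _ _ _ _ S) in *. rewrite (st_xb _ _ _ _ _ _ _ _ _ _ S) in *.
    pose proof (st_e _ _ _ _ _ _ _ _ _ _ S). nra. }
  assert (Yua : Y u < Y a) by (destruct (box u Hu Xu) as [H|H]; [lra|tauto]).
  assert (Hc : Y c - Y u <= 1.43).
  { pose proof (fr_le _ _ _ _ _ _ _ _ _ F Dc).
    pose proof (sq_le (Y a - Y u) (X u - X a) ltac:(lra)).
    pose proof (sq_le (X u - X a) 1.01 ltac:(lra)).
    apply sq_le_inv; [lra|]. pose proof (Rle_0_sqr (X u - X c)). unfold Rsqr in *. lra. }
  destruct (topY p Hp Tp) as [Yap Yup].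
  destruct (classic (c = p)) as [->|Ncp].
  { apply reach_refl. nra. }
  assert (X c <> X p) by (intros E; apply Ncp, (fr_X _ _ _ _ _ F); easy).
  assert (Y c <> Y p) by (intros E; apply Ncp, (fr_Y _ _ _ _ _ F); easy).
  (* The summand 0.45 covers [Y c - Y p], since [Y c - Y u <= 1.43] and [Y p - Y u >= 0.99]. *)
  apply (reach_le _ _ _ _ (kappa * l1 (opp X) Y c p)).
  2:{ apply Rmult_le_compat_l; unfold l1, opp; lra. }
  pose proof (frame_oppX _ _ _ _ _ F) as Fo.
  apply (frame_reach_sym _ _ _ _ _ _ _ _ F).
  destruct (staircase V G D (opp X) Y (fun w => top X y a b w /\ X w < X u) (fun _ _ => False) c p Fo)
    as [R|(? & ? & [] & _)]; unfold opp in *; try easy; try lra.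
  2:{ intros w Vw [Ow1 Ow2] W1 W2.
      destruct (topY w Vw Ow1). destruct Ow1 as [O1 O2].
      assert (L : D u c <= D u w) by (apply Nc; try easy; lra).
      pose proof (fr_le _ _ _ _ _ _ _ _ _ F L).
      pose proof (sq_lt (X u - X w) (X u - X c) ltac:(lra)).
      pose proof (sq_lt (Y w - Y u) (Y c - Y u) ltac:(lra)). lra. }
  2:{ intros w Vw [Ow1 Ow2] W1 W2. apply (Mp w); try easy; lra. }
  intros f f' Hf Hf' Mf Mf' B1 B2 B3 B4 FX FY FR. left.
  destruct Tp as [Tp1 Tp2]. destruct Tc as [Tc1 Tc2].
  assert (topI : forall w, In w V -> X a < X w < X b -> Y a < Y w -> top X y a b w).
  { intros w Vw W1 W2. destruct (box w Vw W1) as [H1|H1]; [split; tauto|lra]. }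
  assert (Tf : top X y a b f) by (apply topI; try easy; lra).
  assert (Tf' : top X y a b f') by (apply topI; try easy; lra).
  destruct (Rle_lt_dec (Y f - Y f') (X f - X f')) as [Hflat|Htall].
  - destruct (link V G D (opp X) Y f f' Fo) as [R|(z2 & A2 & D2 & X2 & Y2)];
      unfold opp in *; try easy; try lra.
    exfalso. destruct A2 as (V2 & _ & X2' & _).
    destruct (box z2 V2) as [Bx|Bx]; [lra| |].
    + apply (Mf' z2); try easy. split; [|lra]. split; [lra|tauto].
    + apply (no_drop _ _ _ _ _ _ _ _ _ _ f f' z2 S); try easy; tauto.
  - destruct (link V G D Y (opp X) f' f (frame_swap _ _ _ _ _ Fo))
      as [R|(z2 & A2 & D2 & X2 & Y2)]; unfold opp in *; try easy; try lra.
    + intros w Vw W1 W2. apply (FR w); easy.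
    + apply (frame_reach_sym _ _ _ _ _ _ _ _ F). eapply reach_le; [exact R|].
      unfold l1. lra.
    + exfalso. destruct A2 as (V2 & _ & Y2' & X2' & _).
      destruct (topY f' Hf' Tf').
      destruct (Rlt_le_dec (X z2) (X u)) as [Hx|Hx].
      * apply (Mf z2); try easy; try lra. split; [|easy]. apply topI; try easy; lra.
      (* An edge passing [u] makes [X u - X f'] smaller than [sqrt 2 * (Y c - Y f')]. As [c] is
         nearest to [u], three times [Y f' - Y u] would then be below [Y c - Y u], but
         [3 * 0.99 > 1.43]. *)
      * assert (L : D u c <= D u f') by (apply Nc; try easy; lra).
        pose proof (fr_le _ _ _ _ _ _ _ _ _ F L).
        pose proof (fr_le _ _ _ _ _ _ _ _ _ F D2).
        pose proof (sq_le (X u - X f') (X z2 - X f') ltac:(lra)).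
        pose proof (sq_lt (X f - X f') (Y f - Y f') ltac:(lra)).
        pose proof (sq_le (Y f - Y f') (Y c - Y f') ltac:(lra)).
        pose proof (Rle_0_sqr (Y f' - Y z2)). pose proof (Rle_0_sqr (X u - X c)).
        unfold Rsqr in *.
        pose proof (Rmult_lt_0_compat (Y c - Y f') (3 * (Y f' - Y u) - (Y c - Y u)) ltac:(lra) ltac:(lra)).
        lra.
Qed.

(** The analogue of [wide_exit] for an edge of [b]: [(P, H)] is [b] relative to [a], [(A, B)] are
    the sides of the step from [u] to [b], and [V] is the height of [v], which is no farther from
    [a] than [b] is. *)
Lemma tall_exit P H B A V o j :
  0 < P -> 0 <= H -> 0 <= A < B -> B + H <= V -> V * V <= P * P + H * H -> 0 < o -> 0 < j ->
  (P + o) * (P + o) + j * j <= A * A + B * B ->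
  H + j <= B /\ B <= P /\ (P + o) * (P + o) + j * j <= 2 * (B * B).
Proof.
  intros HP HH HA HB HV Ho Hj H2.
  pose proof (sq_lt A B ltac:(lra)).
  pose proof (sq_le (B + H) V ltac:(lra)).
  pose proof (Rmult_le_pos B H ltac:(lra) HH).
  assert (B <= P) by (apply sq_le_inv; lra).
  pose proof (Rmult_lt_0_compat P o HP Ho). pose proof (Rmult_lt_0_compat o o Ho Ho).
  pose proof (Rmult_lt_0_compat j j Hj Hj).
  assert (2 * H <= B).
  { apply Rnot_lt_le. intros Hc.
    pose proof (Rmult_lt_0_compat B (2 * H - B) ltac:(lra) ltac:(lra)). lra. }
  assert (j <= B - H) by (apply sq_le_inv; [lra|]; pose proof (Rle_0_sqr H); unfold Rsqr in *; lra).
  repeat split; lra.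
Qed.

(** With [u] the lowest top point not left of [v], the box between [u] and [b] is empty. A failing
    tall link gives an edge of [b] escaping left of [a], and its end is a cheap detour; a failing
    flat link gives an edge falling through the square, kept for the crossing argument. The bound 13
    exceeds [5.5 + kappa * 2.44]. *)
Lemma top_side V G D e x y X Y a b v :
  setting V G D e x y X Y a b -> arc V G D X Y a v -> X v < X b ->
  reach G D a b 13 \/
  exists u z, In u V /\ top X y a b u /\ X v <= X u /\
    reach G D a u (5.5 + kappa * (X u - X a)) /\ Y u - Y b <= X b - X u /\
    arc V G D X (opp Y) u z /\ D u z <= D u b /\ X z < X b /\ y z <= 0.
Proof.
  intros S Av Xvb.
  destruct (setting_size _ _ _ _ _ _ _ _ _ _ S) as (SX & SD & SY).
  pose proof (st_frame _ _ _ _ _ _ _ _ _ _ S) as F.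
  pose proof (st_box _ _ _ _ _ _ _ _ _ _ S) as box.
  pose proof (st_a _ _ _ _ _ _ _ _ _ _ S) as Ha.
  pose proof (st_b _ _ _ _ _ _ _ _ _ _ S) as Hb.
  pose proof (st_ab _ _ _ _ _ _ _ _ _ _ S) as Yab.
  pose proof (first_top_minimal _ _ _ _ _ _ _ _ _ _ _ S Av) as Mv.
  pose proof kappa_bounds as HK.
  assert (Av' := Av). destruct Av' as (Vv & Gv & Xv & Yv & Nv).
  assert (Lab : D a v <= D a b) by (apply Nv; try easy; lra).
  destruct (SY v Lab) as [SYv _].
  assert (Tv : top X y a b v).
  { destruct (box v Vv) as [H|H]; [lra|split; [lra|tauto]|lra]. }
  destruct (list_argmin V Y (fun w => top X y a b w /\ X v <= X w)) as (u & Hu & [Tu Xvu] & Umin).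
  { exists v. split; [easy|]. split; [easy|lra]. }
  assert (Yuv : Y u <= Y v) by (apply Umin; [easy|split; [easy|lra]]).
  assert (low : forall w, In w V -> top X y a b w -> Y w < Y u -> X v <= X w \/ X w < X u -> False).
  { intros w Vw Tw W1 W2. destruct (Rle_lt_dec (X v) (X w)) as [H|H].
    - assert (Y u <= Y w) by (apply Umin; easy). lra.
    - apply (Mv w); try easy; lra. }
  assert (Ru : reach G D a u (5.5 + kappa * (X u - X a))).
  { apply (reach_top _ _ _ _ _ _ _ _ _ _ v u S); try easy.
    intros w Vw Ow W1 W2. apply (low w); auto. }
  destruct Tu as [Tu1 Tu2].
  assert (Yub : Y b < Y u) by (destruct (box u Hu Tu1) as [H|H]; [tauto|lra]).
  assert (Hempty : forall w, In w V -> X u < X w < X b -> Y b < Y w < Y u -> False).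
  { intros w Vw W1 W2. destruct (box w Vw) as [H|H]; [lra| |lra].
    apply (low w); [easy|split; [lra|tauto]|lra|left; lra]. }
  assert (fin : reach G D u b (kappa * ((X b - X u) + (Y u - Y b))) -> reach G D a b 13).
  { intros R. eapply reach_trans; [exact Ru|exact R|].
    pose proof (Rmult_le_compat_l kappa (X u - X a + ((X b - X u) + (Y u - Y b))) (1.01 + 1.43)
      ltac:(lra) ltac:(lra)).
    lra. }
  destruct (Rle_lt_dec (Y u - Y b) (X b - X u)) as [Hflat|Htall].
  - destruct (link V G D X Y u b F) as [R|(z & Az & Dz & Zx & Zy)]; try easy; try lra.
    + left. apply fin. exact R.
    + right. exists u, z. split; [easy|]. split; [easy|].
      repeat (split; [easy|]).
      destruct Az as (Vz & _ & Xz & _).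
      destruct (box z Vz) as [H|H]; [lra|lra|tauto].
  - left.
    destruct (link V G D Y X b u (frame_swap _ _ _ _ _ F)) as [R|(z & Az & Dz & Zx & Zy)]; try easy; try lra.
    + intros w Vw W1 W2. apply (Hempty w); easy.
    + apply fin. apply (frame_reach_sym _ _ _ _ _ _ _ _ F). eapply reach_le; [exact R|].
      unfold l1. lra.
    + assert (Az' := Az). destruct Az' as (Vz & Gz & Yz & Xz & _). unfold opp in Xz.
      assert (Xza : X z < X a).
      { apply Rnot_le_lt. intros [H|H].
        - destruct (box z Vz) as [B1|B1]; [lra| |lra].
          apply (low z); try easy; [split; [lra|tauto]|right; lra].
        - apply (fr_X _ _ _ _ _ F) in H; try easy. subst; lra. }
      pose proof (fr_le _ _ _ _ _ _ _ _ _ F Lab).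
      pose proof (fr_le _ _ _ _ _ _ _ _ _ F Dz).
      destruct (tall_exit (X b - X a) (Y b - Y a) (Y u - Y b) (X b - X u) (Y v - Y a) (X a - X z) (Y z - Y b))
        as (W1 & W2 & W3); try lra.
      { pose proof (Rle_0_sqr (X v - X a)). unfold Rsqr in *. lra. }
      pose proof (sq_le (Y u - Y b) 1.01 ltac:(lra)).
      assert (X b - X z <= 1.43).
      { apply sq_le_inv; [lra|]. pose proof (Rle_0_sqr (Y z - Y b)). unfold Rsqr in *. lra. }
      apply (reach_trans _ _ _ z _ (kappa * l1 X Y z a) 1.43).
      * apply (frame_reach_sym _ _ _ _ _ _ _ _ F).
        apply (left_travel V G D X Y b z a); try easy; try lra.
        -- now apply arc_swap.
        -- intros w Vw U1 U2. destruct (box w Vw U1) as [B1|B1]; lra.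
      * apply reach_edge; [now apply (fr_sym _ _ _ _ _ F)|].
        rewrite (fr_Dsym _ _ _ _ _ z b F).
        apply (fr_bound _ _ _ _ _ _ _ _ F); lra.
      * pose proof (Rmult_le_compat_l kappa (l1 X Y z a) (0.44 + 1.01) ltac:(lra) ltac:(unfold l1; lra)).
        lra.
Qed.

(** The half-turn exchanges [a] with [b] and top with bottom but keeps [e] and the order in [Y], so
    facts about the top side seen from [a] become facts about the bottom side seen from [b]. *)
Lemma setting_rot V G D e x y X Y a b :
  setting V G D e x y X Y a b ->
  setting V G D e (fun p => 1 - x p) (fun p => 1 - y p)
    (fun p => 1 + e - X p) (fun p => 1 - e - Y p) b a.
Proof.
  intros [F EX EY ED He wx wy Ha Hb xa xb ya yb ab fl box].
  split; try easy; try lra.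
  - apply (frame_congr _ _ _ (opp X) (opp Y)); try (intros; unfold opp; ring).
    apply frame_oppY, frame_oppX, F.
  - intros p. rewrite EX. ring.
  - intros p. rewrite EY. ring.
  - intros p q. rewrite ED. ring.
  - intros p q Hp Hq H. pose proof (wx q p Hq Hp ltac:(lra)). lra.
  - intros p q Hp Hq H. pose proof (wy q p Hq Hp ltac:(lra)). lra.
  - intros w Vw H. destruct (box w Vw) as [H1|H1]; [lra|right|left]; lra.
Qed.

(** An edge of [a] that passes [b] is led back by [overshoot], at a total cost of at most
    [1.415 + kappa * 1.45]. *)
Lemma first_edge V G D e x y X Y a b :
  setting V G D e x y X Y a b ->
  reach G D a b 13 \/ exists v, arc V G D X Y a v /\ X v < X b.
Proof.
  intros S.
  destruct (setting_size _ _ _ _ _ _ _ _ _ _ S) as (SX & SD & SY).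
  pose proof (st_frame _ _ _ _ _ _ _ _ _ _ S) as F.
  pose proof (st_box _ _ _ _ _ _ _ _ _ _ S) as box.
  pose proof (st_a _ _ _ _ _ _ _ _ _ _ S) as Ha.
  pose proof (st_b _ _ _ _ _ _ _ _ _ _ S) as Hb.
  pose proof (st_ab _ _ _ _ _ _ _ _ _ _ S) as Yab.
  pose proof (st_flat _ _ _ _ _ _ _ _ _ _ S) as fl.
  pose proof kappa_bounds as HK.
  destruct (fr_pp _ _ _ _ _ F a b Ha Hb) as [v Av]; try lra.
  destruct (Rlt_le_dec (X v) (X b)) as [Hx|Hx]; [right; eauto|left].
  assert (Av' := Av). destruct Av' as (Vv & Gv & Xv & Yv & Nv).
  assert (Lab : D a v <= D a b) by (apply Nv; try easy; lra).
  destruct (SY v Lab) as [_ SXv].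
  assert (Ev : reach G D a v 1.415) by (apply reach_edge; [easy|lra]).
  destruct (classic (v = b)) as [<-|Nvb].
  - eapply reach_le; [exact Ev|lra].
  - assert (X v <> X b) by (intros E; apply Nvb, (fr_X _ _ _ _ _ F); easy).
    eapply reach_trans; [exact Ev| |].
    + apply (overshoot V G D X Y a b v F); try easy; try lra.
      intros w Vw W1 W2. destruct (box w Vw W1) as [H1|H1]; lra.
    + pose proof (Rmult_le_compat_l kappa (l1 X Y b v) (0.44 + 1.01) ltac:(lra) ltac:(unfold l1; lra)).
      lra.
Qed.

Lemma reach_box V G D e x y X Y a b :
  setting V G D e x y X Y a b -> reach G D a b 17.
Proof.
  intros S. pose proof (setting_rot _ _ _ _ _ _ _ _ _ _ S) as S'.
  destruct (setting_size _ _ _ _ _ _ _ _ _ _ S) as (SX & SD & SY).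
  pose proof (st_frame _ _ _ _ _ _ _ _ _ _ S) as F.
  pose proof (st_frame _ _ _ _ _ _ _ _ _ _ S') as F'.
  destruct (first_edge _ _ _ _ _ _ _ _ _ _ S) as [R|(v & Av & Xvb)];
    [eapply reach_le; [exact R|lra]|].
  destruct (first_edge _ _ _ _ _ _ _ _ _ _ S') as [R|(w & Aw & Xwa)];
    [apply (frame_reach_sym _ _ _ _ _ _ _ _ F); eapply reach_le; [exact R|lra]|].
  destruct (top_side _ _ _ _ _ _ _ _ _ _ _ S Av Xvb)
    as [R|(u & z & Hu & [Tu1 Tu2] & Xvu & _ & _ & Az & Dz & Xz & Zy)];
    [eapply reach_le; [exact R|lra]|].
  destruct (top_side _ _ _ _ _ _ _ _ _ _ _ S' Aw Xwa)
    as [R|(u' & c & Hu' & [Tu1' Tu2'] & _ & Ru' & Hfl & Ac & Dc & Xc & Cy)];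
    [apply (frame_reach_sym _ _ _ _ _ _ _ _ F); eapply reach_le; [exact R|lra]|].
  pose proof (first_top_minimal _ _ _ _ _ _ _ _ _ _ _ S Av) as Mv.
  pose proof (st_box _ _ _ _ _ _ _ _ _ _ S) as box.
  pose proof (st_a _ _ _ _ _ _ _ _ _ _ S) as Ha.
  pose proof (st_b _ _ _ _ _ _ _ _ _ _ S) as Hb.
  pose proof (st_ab _ _ _ _ _ _ _ _ _ _ S) as Yab.
  pose proof (st_D _ _ _ _ _ _ _ _ _ _ S) as ED.
  pose proof (st_xa _ _ _ _ _ _ _ _ _ _ S) as xa.
  pose proof (st_xb _ _ _ _ _ _ _ _ _ _ S) as xb.
  pose proof (st_ya _ _ _ _ _ _ _ _ _ _ S) as ya.
  pose proof (st_yb _ _ _ _ _ _ _ _ _ _ S) as yb.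
  pose proof (st_wx _ _ _ _ _ _ _ _ _ _ S) as wx.
  pose proof kappa_bounds as HK.
  clear S' F' Aw Xwa w.
  assert (Av' := Av). destruct Av' as (Vv & Gv & Xv & Yv & Nv).
  assert (Ac0 : arc V G D (opp X) Y u' c)
    by (eapply arc_congr; [| |exact Ac]; intros; unfold opp; ring).
  clear Ac. assert (Ac' := Ac0). destruct Ac' as (Vc & Gc & Xuc & Yuc & Nc).
  unfold opp in Xuc, Nc. destruct Az as (Vz & _ & Xuz & _ & _).
  assert (Tv : top X y a b v).
  { destruct (box v Vv) as [H|H]; [lra|split; [lra|tauto]|lra]. }
  assert (Yu' : Y u' < Y a) by (destruct (box u' Hu') as [H|H]; [lra|lra|tauto]).
  assert (Yc : Y a < Y c) by (destruct (box c Vc) as [H|H]; [lra|tauto|lra]).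
  (* The falling edge at [u] gives [y b <= 1 - x u], the rising edge at [u'] gives
     [1 - y a <= x u']. If [u'] were left of [v], hence of [u], then [y a = y b] and [x u' = x v];
     breaking these two ties requires opposite signs of [e]. *)
  assert (Xvu' : X v <= X u').
  { apply Rnot_lt_le. intros Hc.
    assert (H1 : D u z * D u z <= D u b * D u b) by (apply sq_le; split; [apply (fr_D _ _ _ _ _ F)|easy]).
    assert (H2 : D u' c * D u' c <= D u' a * D u' a) by (apply sq_le; split; [apply (fr_D _ _ _ _ _ F)|easy]).
    rewrite !ED in H1, H2. rewrite xa in H2. rewrite xb in H1.
    pose proof (wx u' v Hu' Vv Hc).
    assert (x v <= x u) by (destruct Xvu as [H3|H3];
      [now apply wx|apply (fr_X _ _ _ _ _ F) in H3; try easy; subst; lra]).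
    pose proof (wx u b Hu Hb ltac:(lra)). pose proof (wx a u' Ha Hu' ltac:(lra)).
    pose proof (st_wy _ _ _ _ _ _ _ _ _ _ S a b Ha Hb Yab).
    pose proof (Rle_0_sqr (x u - x z)). pose proof (Rle_0_sqr (x u' - x c)). unfold Rsqr in *.
    pose proof (sq_le (y u) (y u - y z) ltac:(lra)).
    pose proof (sq_le (1 - y u') (y c - y u') ltac:(lra)).
    pose proof (Rmult_le_pos (y b) (2 * y u - 2 * y b) ltac:(lra) ltac:(lra)).
    pose proof (Rmult_le_pos (1 - y a) (2 * y a - 2 * y u') ltac:(lra) ltac:(lra)).
    assert (y b <= 1 - x u) by (apply sq_le_inv; lra).
    assert (1 - y a <= x u') by (apply sq_le_inv; lra).
    rewrite !(st_X _ _ _ _ _ _ _ _ _ _ S) in Hc. rewrite !(st_Y _ _ _ _ _ _ _ _ _ _ S) in Yab.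
    assert (x u' = x v) as Exv by lra. assert (y a = y b) as Eab by lra.
    rewrite Exv in Hc. rewrite Eab, xa, xb in Yab. destruct Tv. nra. }
  (* Otherwise an exchange works: depending on which of [c], [v] is higher, [c] is strictly nearer
     to [a] than [v], or [v] strictly nearer to [u'] than [c]. *)
  assert (Xvc : X v <= X c).
  { apply Rnot_lt_le. intros Hc.
    assert (Nvu : X v <> X u').
    { intros E. apply (fr_X _ _ _ _ _ F) in E; try easy. subst. lra. }
    assert (L1 : D u' c <= D u' v) by (apply Nc; try easy; lra).
    assert (L2 : D a v <= D a c) by (apply Nv; try easy; lra).
    pose proof (fr_le _ _ _ _ _ _ _ _ _ F L1). pose proof (fr_le _ _ _ _ _ _ _ _ _ F L2).
    pose proof (sq_lt (X u' - X v) (X u' - X c) ltac:(lra)).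
    pose proof (sq_lt (X c - X a) (X v - X a) ltac:(lra)).
    destruct (Rle_lt_dec (Y c) (Y v)).
    - pose proof (sq_le (Y c - Y a) (Y v - Y a) ltac:(lra)). lra.
    - pose proof (sq_le (Y v - Y u') (Y c - Y u') ltac:(lra)). lra. }
  (* The lowest point between [v] and [c] is the hinge: it is minimal both for the staircase
     descending from [v] and for the mirrored one descending from [c]. *)
  destruct (list_argmin V Y (fun w => top X y a b w /\ X v <= X w <= X c)) as (p & Hp & [Tp Xp] & Pmin).
  { exists v. split; [easy|]. split; [easy|lra]. }
  assert (Ypv : Y p <= Y v) by (apply Pmin; [easy|split; [easy|lra]]).
  assert (Ypc : Y p <= Y c) by (apply Pmin; [easy|split; [split; lra|lra]]).
  assert (R1 : reach G D a p (5.5 + kappa * (X p - X a))).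
  { apply (reach_top _ _ _ _ _ _ _ _ _ _ v p S); try easy.
    intros w Vw Ow W1 W2. destruct (Rle_lt_dec (X v) (X w)).
    - assert (Y p <= Y w) by (apply Pmin; [easy|split; [easy|lra]]). lra.
    - apply (Mv w); try easy; lra. }
  assert (R2 : reach G D p c (kappa * ((X c - X p) + 0.45))).
  { apply (reach_right _ _ _ _ _ _ _ _ _ _ u' c p S); try easy; try lra.
    intros w Vw Ow W1 W2 W3. destruct (Rle_lt_dec (X w) (X c)).
    - assert (Y p <= Y w) by (apply Pmin; [easy|split; [easy|lra]]). lra.
    - assert (Yw : Y a < Y w) by (destruct Ow as [O1 O2]; destruct (box w Vw O1); [tauto|lra]).
      assert (L1 : D u' c <= D u' w) by (apply Nc; try easy; lra).
      pose proof (fr_le _ _ _ _ _ _ _ _ _ F L1).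
      pose proof (sq_lt (X u' - X w) (X u' - X c) ltac:(lra)).
      pose proof (sq_le (Y w - Y u') (Y c - Y u') ltac:(lra)). lra. }
  assert (R3 : reach G D c u' 1.43).
  { apply reach_edge; [now apply (fr_sym _ _ _ _ _ F)|].
    rewrite (fr_Dsym _ _ _ _ _ c u' F). apply Rle_trans with (1 := Dc).
    apply (fr_bound _ _ _ _ _ _ _ _ F); [lra|].
    pose proof (sq_le (Y a - Y u') (X u' - X a) ltac:(lra)).
    pose proof (sq_le (X u' - X a) 1.01 ltac:(lra)). lra. }
  apply (frame_reach_sym _ _ _ _ _ _ _ _ F) in Ru'.
  eapply (reach_trans _ _ _ p); [exact R1| |].
  { eapply (reach_trans _ _ _ c); [exact R2| |apply Rle_refl].
    eapply (reach_trans _ _ _ u'); [exact R3|exact Ru'|apply Rle_refl]. }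
  (* Since [X c < X u'], the horizontal parts add up to at most [X b - X a]; the total is
     [5.5 + 1.43 + 5.5 + kappa * 1.46 < 17]. *)
  pose proof (Rmult_le_compat_l kappa
    ((X p - X a) + ((X c - X p) + 0.45) + (1 + e - X u' - (1 + e - X b))) (1.01 + 0.45)
    ltac:(lra) ltac:(lra)).
  lra.
Qed.

(** * Ties on the boundary of the square *)

(** [ax_flat] and [ax_steep] assume strict inequalities because the rotation may break a tie between
    width and height either way; flat and steep are therefore decided in [X], [Y] later on. *)
Record axes V G (D : pt -> pt -> R) (e : R) (x y X Y : pt -> R) : Prop := {
  ax_frame : frame V G D X Y;
  ax_X : forall p, X p = x p + e * y p;
  ax_Y : forall p, Y p = y p - e * x p;
  ax_D : forall p q, D p q * D p q = (x p - x q) * (x p - x q) + (y p - y q) * (y p - y q);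
  ax_e : -1/100 <= e <= 1/100;
  ax_wx : forall p q, In p V -> In q V -> X p < X q -> x p <= x q;
  ax_wy : forall p q, In p V -> In q V -> Y p < Y q -> y p <= y q;
  ax_flat : forall p q, In p V -> In q V ->
    (y p - y q) * (y p - y q) < (x p - x q) * (x p - x q) ->
    (Y p - Y q) * (Y p - Y q) < (X p - X q) * (X p - X q);
  ax_steep : forall p q, In p V -> In q V ->
    (x p - x q) * (x p - x q) < (y p - y q) * (y p - y q) ->
    (X p - X q) * (X p - X q) < (Y p - Y q) * (Y p - Y q) }.

Lemma axes_congr V G D e x y X Y x' y' X' Y' :
  (forall p q, x' p - x' q = x p - x q) -> (forall p q, y' p - y' q = y p - y q) ->
  (forall p, X' p = x' p + e * y' p) -> (forall p, Y' p = y' p - e * x' p) ->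
  axes V G D e x y X Y -> axes V G D e x' y' X' Y'.
Proof.
  intros dx dy EX' EY' [F EX EY ED He wx wy fl st].
  assert (dX : forall p q, X' p - X' q = X p - X q).
  { intros p q. rewrite !EX, !EX'. pose proof (dx p q). pose proof (dy p q). nra. }
  assert (dY : forall p q, Y' p - Y' q = Y p - Y q).
  { intros p q. rewrite !EY, !EY'. pose proof (dx p q). pose proof (dy p q). nra. }
  split; try easy.
  - now apply (frame_congr _ _ _ X Y).
  - intros p q. now rewrite dx, dy.
  - intros p q Hp Hq H. pose proof (wx p q Hp Hq). pose proof (dx p q). pose proof (dX p q). lra.
  - intros p q Hp Hq H. pose proof (wy p q Hp Hq). pose proof (dy p q). pose proof (dY p q). lra.
  - intros p q Hp Hq. rewrite dx, dy, dX, dY. auto.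
  - intros p q Hp Hq. rewrite dx, dy, dX, dY. auto.
Qed.

Lemma axes_oppx V G D e x y X Y :
  axes V G D e x y X Y -> axes V G D (- e) (opp x) y (opp X) Y.
Proof.
  intros [F EX EY ED He wx wy fl st]. unfold opp.
  split; try easy; try lra.
  - apply (frame_oppX _ _ _ _ _ F).
  - intros p. rewrite EX. ring.
  - intros p. rewrite EY. ring.
  - intros p q. rewrite ED. ring.
  - intros p q Hp Hq H. pose proof (wx q p Hq Hp). lra.
  - intros p q Hp Hq H. specialize (fl p q Hp Hq). lra.
  - intros p q Hp Hq H. specialize (st p q Hp Hq). lra.
Qed.

Lemma axes_swap V G D e x y X Y :
  axes V G D e x y X Y -> axes V G D (- e) y x Y X.
Proof.
  intros [F EX EY ED He wx wy fl st].
  split; try easy; try lra.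
  - apply (frame_swap _ _ _ _ _ F).
  - intros p. rewrite EY. ring.
  - intros p. rewrite EX. ring.
  - intros p q. rewrite ED. ring.
Qed.

Lemma axes_flipx V G D e x y X Y :
  axes V G D e x y X Y ->
  axes V G D (- e) (fun p => 1 - x p) y (fun p => 1 - X p) (fun p => Y p - e * -1).
Proof.
  intros A. pose proof (ax_X _ _ _ _ _ _ _ _ A) as EX. pose proof (ax_Y _ _ _ _ _ _ _ _ A) as EY.
  apply (axes_congr _ _ _ _ (opp x) y (opp X) Y); try (now apply axes_oppx).
  - intros; unfold opp; ring.
  - intros; ring.
  - intros p. rewrite EX. ring.
  - intros p. rewrite EY. ring.
Qed.

Lemma axes_flipy V G D e x y X Y :
  axes V G D e x y X Y ->
  axes V G D (- e) x (fun p => 1 - y p) (fun p => X p - e) (fun p => 1 - Y p).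
Proof.
  intros A. pose proof (ax_X _ _ _ _ _ _ _ _ A) as EX. pose proof (ax_Y _ _ _ _ _ _ _ _ A) as EY.
  pose proof (axes_swap _ _ _ _ _ _ _ _ (axes_flipx _ _ _ _ _ _ _ _ (axes_swap _ _ _ _ _ _ _ _ A))) as A'.
  rewrite !Ropp_involutive in A'.
  apply (axes_congr _ _ _ _ x (fun p => 1 - y p) (fun p => X p - - e * -1) (fun p => 1 - Y p)); try easy.
  - intros p. rewrite EX. ring.
  - intros p. rewrite EY. ring.
Qed.

Lemma axes_scale V G D e x y X Y s :
  0 < s -> axes V G D e x y X Y ->
  axes V G (fun p q => D p q / s) e (fun p => x p / s) (fun p => y p / s)
    (fun p => X p / s) (fun p => Y p / s).
Proof.
  intros Hs [F EX EY ED He wx wy fl st].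
  assert (Hi : 0 < / s) by now apply Rinv_0_lt_compat.
  assert (lt_s : forall u v, u / s < v / s <-> u < v).
  { intros u v. unfold Rdiv. split; intros H; [apply Rmult_lt_reg_r in H; easy|].
    now apply Rmult_lt_compat_r. }
  assert (sq_s : forall u v, (u / s - v / s) * (u / s - v / s) = ((u - v) * (u - v)) * (/ s * / s))
    by (intros; unfold Rdiv; ring).
  assert (Hii : 0 < / s * / s) by now apply Rmult_lt_0_compat.
  assert (arcs : forall X Y u v, arc V G D X Y u v ->
    arc V G (fun p q => D p q / s) (fun p => X p / s) (fun p => Y p / s) u v).
  { intros X' Y' u v (H1 & H2 & H3 & H4 & H5).
    split; [easy|]. split; [easy|]. split; [now apply lt_s|]. split; [now apply lt_s|].
    intros w Vw W1 W2. cbv beta in W1, W2. apply (proj1 (lt_s _ _)) in W1; apply (proj1 (lt_s _ _)) in W2.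
    apply Rmult_le_compat_r; [lra|]. now apply H5. }
  assert (ys : forall X Y, yao_quadrant V G D X Y ->
    yao_quadrant V G (fun p q => D p q / s) (fun p => X p / s) (fun p => Y p / s)).
  { intros X' Y' HY u w Hu Hw W1 W2. apply (proj1 (lt_s _ _)) in W1; apply (proj1 (lt_s _ _)) in W2.
    destruct (HY u w Hu Hw W1 W2) as [v Hv]. exists v. now apply arcs. }
  assert (ys' : forall X Y X' Y', (forall p, X' p = X p / s) -> (forall p, Y' p = Y p / s) ->
    yao_quadrant V G D X Y -> yao_quadrant V G (fun p q => D p q / s) X' Y').
  { intros X0 Y0 X' Y' E1 E2 HY.
    apply (yao_quadrant_congr _ _ _ (fun p => X0 p / s) (fun p => Y0 p / s)); [| |now apply ys];
      intros; now rewrite ?E1, ?E2. }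
  split; try easy.
  - destruct F as [S D0 [k [Hk M]] IX IY pp np pn nn].
    split; try easy.
    + intros p q. unfold Rdiv. apply Rmult_le_pos; [easy|lra].
    + exists k. split; [easy|]. intros p q. rewrite !sq_s, <- Rmult_plus_distr_r, <- M.
      unfold Rdiv. ring.
    + intros p q Hp Hq E. apply IX; try easy.
      unfold Rdiv in E. apply Rmult_eq_reg_r in E; lra.
    + intros p q Hp Hq E. apply IY; try easy.
      unfold Rdiv in E. apply Rmult_eq_reg_r in E; lra.
    + now apply ys.
    + eapply ys'; [| |exact np]; intros; unfold opp, Rdiv; ring.
    + eapply ys'; [| |exact pn]; intros; unfold opp, Rdiv; ring.
    + eapply ys'; [| |exact nn]; intros; unfold opp, Rdiv; ring.
  - intros p. rewrite EX. unfold Rdiv. ring.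
  - intros p. rewrite EY. unfold Rdiv. ring.
  - intros p q. rewrite !sq_s, <- Rmult_plus_distr_r, <- ED. unfold Rdiv. ring.
  - intros p q Hp Hq H. apply (proj1 (lt_s _ _)) in H. unfold Rdiv. apply Rmult_le_compat_r; [lra|auto].
  - intros p q Hp Hq H. apply (proj1 (lt_s _ _)) in H. unfold Rdiv. apply Rmult_le_compat_r; [lra|auto].
  - intros p q Hp Hq. rewrite !sq_s. intros H. apply Rmult_lt_reg_r in H; [|easy].
    apply Rmult_lt_compat_r; [easy|auto].
  - intros p q Hp Hq. rewrite !sq_s. intros H. apply Rmult_lt_reg_r in H; [|easy].
    apply Rmult_lt_compat_r; [easy|auto].
Qed.

Lemma axes_X_lt V G D e x y X Y p q :
  axes V G D e x y X Y -> In p V -> In q V -> x p < x q -> X p < X q.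
Proof.
  intros A Hp Hq H. apply Rnot_le_lt. intros [H1|H1].
  - pose proof (ax_wx _ _ _ _ _ _ _ _ A q p Hq Hp H1). lra.
  - apply (fr_X _ _ _ _ _ (ax_frame _ _ _ _ _ _ _ _ A)) in H1; try easy. subst; lra.
Qed.

Lemma axes_Y_lt V G D e x y X Y p q :
  axes V G D e x y X Y -> In p V -> In q V -> y p < y q -> Y p < Y q.
Proof. intros A. apply (axes_X_lt _ _ _ _ _ _ _ _ _ _ (axes_swap _ _ _ _ _ _ _ _ A)). Qed.

Lemma axes_eq V G D e x y X Y p q :
  axes V G D e x y X Y -> In p V -> In q V -> x p = x q -> y p = y q -> p = q.
Proof.
  intros A Hp Hq H1 H2. apply (fr_X _ _ _ _ _ (ax_frame _ _ _ _ _ _ _ _ A)); try easy.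
  rewrite !(ax_X _ _ _ _ _ _ _ _ A), H1, H2. reflexivity.
Qed.

Definition unit_empty (V : list pt) (x y : pt -> R) : Prop :=
  forall w, In w V -> 0 < x w < 1 -> 0 < y w < 1 -> False.

(** For [e > 0] the points further up the left side are in the open quadrant of [p]. A nearest point
    there that left the side would be inside the empty square, as [y q - y p < 1]; so Yao edges
    climb the side without overshooting [q], and their lengths telescope. *)
Lemma vertical V G D e x y X Y p q :
  axes V G D e x y X Y -> unit_empty V x y -> 0 < e ->
  In p V -> In q V -> x p = 0 -> x q = 0 -> 0 <= y p -> y p < y q -> y q < 1 ->
  reach G D p q (y q - y p).
Proof.
  intros A U He Hp Hq. revert p q Hp Hq.
  apply (pair_real_ind V (fun p q => y q - y p) (fun p q =>
    x p = 0 -> x q = 0 -> 0 <= y p -> y p < y q -> y q < 1 -> reach G D p q (y q - y p))).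
  intros p q Hp Hq IH xp xq yp ypq yq.
  pose proof (ax_frame _ _ _ _ _ _ _ _ A) as F.
  pose proof (axes_Y_lt _ _ _ _ _ _ _ _ p q A Hp Hq ypq) as Ypq.
  destruct (fr_pp _ _ _ _ _ F p q Hp Hq) as [v (Vv & Gv & Xv & Yv & Nv)]; [|easy|].
  { rewrite !(ax_X _ _ _ _ _ _ _ _ A), xp, xq. nra. }
  assert (Xpq : X p < X q) by (rewrite !(ax_X _ _ _ _ _ _ _ _ A), xp, xq; nra).
  assert (L : D p v <= D p q) by now apply Nv.
  pose proof (ax_wx _ _ _ _ _ _ _ _ A p v Hp Vv Xv) as xv.
  pose proof (ax_wy _ _ _ _ _ _ _ _ A p v Hp Vv Yv) as yv.
  assert (L2 : D p v * D p v <= D p q * D p q)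
    by (apply sq_le; split; [apply (fr_D _ _ _ _ _ F)|easy]).
  rewrite !(ax_D _ _ _ _ _ _ _ _ A), xp, xq in L2. rewrite xp in xv.
  assert (x v < 1) by nra. assert (y v <= y q) by nra.
  assert (xv0 : x v = 0).
  { destruct (Req_dec (x v) 0) as [E|E]; [easy|exfalso].
    destruct (Rle_lt_dec (y v) 0) as [H1|H1].
    - rewrite !(ax_Y _ _ _ _ _ _ _ _ A), xp in Yv. nra.
    - apply (U v); try easy; lra. }
  assert (yv' : y p < y v) by (rewrite !(ax_Y _ _ _ _ _ _ _ _ A), xp, xv0 in Yv; lra).
  assert (Dv : D p v <= y v - y p).
  { apply sq_le_inv; [lra|]. rewrite (ax_D _ _ _ _ _ _ _ _ A), xp, xv0. lra. }
  destruct (Req_dec (y v) (y q)) as [E|E].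
  - assert (v = q) by (apply (axes_eq _ _ _ _ _ _ _ _ v q A); try easy; lra).
    subst v. now apply reach_edge.
  - eapply reach_trans; [apply reach_edge; [exact Gv|exact Dv]| |].
    + apply (IH v q); try easy; lra.
    + lra.
Qed.

(** Points of the open left side could lie strictly between [a] and [b] in [X] without being above
    or below the square. Moving to the one with greatest [X] removes them; the sign of [e] decides
    whether this means up or down. *)
Lemma left_extreme V G D e x y X Y a :
  axes V G D e x y X Y -> unit_empty V x y -> In a V -> x a = 0 -> 0 <= y a <= 1 ->
  exists a', In a' V /\ x a' = 0 /\ (a' = a \/ 0 < y a' < 1) /\
    (forall w, In w V -> x w = 0 -> 0 < y w < 1 -> X w <= X a') /\
    X a <= X a' /\ reach G D a a' 1.
Proof.
  intros A U Ha xa ya.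
  destruct (list_argmin V (fun w => - X w) (fun w => w = a \/ (x w = 0 /\ 0 < y w < 1)))
    as (a' & Ha' & Pa & Pmin).
  { exists a. auto. }
  exists a'. split; [easy|].
  split; [destruct Pa as [->|Pa]; tauto|]. split; [tauto|].
  split; [intros w Vw W1 W2; assert (- X a' <= - X w) by (apply Pmin; auto); lra|].
  assert (X a <= X a') by (assert (- X a' <= - X a) by (apply Pmin; auto); lra).
  split; [easy|].
  destruct (classic (a' = a)) as [->|Na]; [apply reach_refl; lra|].
  destruct Pa as [Pa|[xa' ya']]; [easy|].
  assert (Ne : y a <> y a').
  { intros E. apply Na. symmetry. apply (axes_eq _ _ _ _ _ _ _ _ a a' A); try easy; lra. }
  rewrite !(ax_X _ _ _ _ _ _ _ _ A), xa, xa' in H.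
  destruct (Rle_lt_dec (y a') (y a)) as [Hy|Hy].
  - apply (reach_le _ _ _ _ (1 - y a' - (1 - y a))); [|lra].
    apply (vertical V G D (- e) x (fun p => 1 - y p) _ _ a a' (axes_flipy _ _ _ _ _ _ _ _ A));
      try easy; try lra.
    + intros w Vw W1 W2. apply (U w); try easy; lra.
    + assert (e <> 0).
      { intros E. assert (X a = X a') by (rewrite !(ax_X _ _ _ _ _ _ _ _ A), xa, xa', E; lra).
        apply Na. symmetry. now apply (fr_X _ _ _ _ _ (ax_frame _ _ _ _ _ _ _ _ A)). }
      nra.
  - apply (reach_le _ _ _ _ (y a' - y a)); [|lra].
    apply (vertical V G D e x y _ _ a a' A); try easy; try lra.
    assert (e <> 0).
    { intros E. assert (X a = X a') by (rewrite !(ax_X _ _ _ _ _ _ _ _ A), xa, xa', E; lra).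
      apply Na. symmetry. now apply (fr_X _ _ _ _ _ (ax_frame _ _ _ _ _ _ _ _ A)). }
    nra.
Qed.

Definition shorter_ok V G D (x y : pt -> R) (C d : R) : Prop :=
  forall p q, In p V -> In q V -> p <> q -> 0 <= x p <= 1 -> 0 <= x q <= 1 ->
    0 <= y p <= 1 -> 0 <= y q <= 1 -> D p q < d -> reach G D p q (C * D p q).

(* Points on the bottom side that the rotation puts above [a] are not below the square in [Y];
   the Yao edge of [a] then runs along that side and gains enough for the induction. *)
Lemma corner V G D e x y X Y a b p C :
  axes V G D e x y X Y -> unit_empty V x y -> 20 <= C ->
  In a V -> In b V -> In p V -> x a = 0 -> y a = 0 -> x b = 1 -> 0 <= y b <= 1 ->
  y p = 0 -> 0 < x p < 1 -> Y a < Y p -> shorter_ok V G D x y C (D a b) ->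
  reach G D a b (C * D a b).
Proof.
  intros A U HC Ha Hb Hp xa ya xb yb yp xp Yp IH.
  pose proof (ax_frame _ _ _ _ _ _ _ _ A) as F.
  pose proof (axes_X_lt _ _ _ _ _ _ _ _ a p A Ha Hp ltac:(lra)) as Xp.
  destruct (fr_pp _ _ _ _ _ F a p Ha Hp Xp Yp) as [v (Vv & Gv & Xv & Yv & Nv)].
  assert (L : D a v <= D a p) by now apply Nv.
  pose proof (ax_wx _ _ _ _ _ _ _ _ A a v Ha Vv Xv) as xv.
  pose proof (ax_wy _ _ _ _ _ _ _ _ A a v Ha Vv Yv) as yv.
  pose proof (fr_D _ _ _ _ _ F) as D0.
  assert (L2 : D a v * D a v <= D a p * D a p) by (apply sq_le; split; [apply D0|easy]).
  rewrite !(ax_D _ _ _ _ _ _ _ _ A), xa, ya, yp in L2. rewrite xa in xv. rewrite ya in yv.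
  assert (x v <= x p) by nra. assert (y v <= x p) by nra.
  rewrite !(ax_Y _ _ _ _ _ _ _ _ A), xa, ya in Yp, Yv. rewrite yp in Yp.
  rewrite !(ax_X _ _ _ _ _ _ _ _ A), xa, ya in Xv.
  assert (He : e < 0) by nra.
  assert (yv0 : y v = 0).
  { destruct (Req_dec (y v) 0) as [E|E]; [easy|exfalso].
    destruct (Rle_lt_dec (x v) 0) as [H1|H1]; [nra|]. apply (U v); try easy; lra. }
  rewrite yv0 in Xv. assert (xv' : 0 < x v) by lra.
  assert (Dv : D a v <= x v).
  { apply sq_le_inv; [lra|]. rewrite (ax_D _ _ _ _ _ _ _ _ A), xa, ya, yv0. lra. }
  pose proof (D0 a b). pose proof (D0 v b).
  assert (E1 : D a b * D a b = 1 + y b * y b)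
    by (rewrite (ax_D _ _ _ _ _ _ _ _ A), xa, ya, xb; ring).
  assert (E2 : D v b * D v b = (1 - x v) * (1 - x v) + y b * y b)
    by (rewrite (ax_D _ _ _ _ _ _ _ _ A), yv0, xb; ring).
  assert (Hlt : D v b < D a b).
  { apply Rnot_le_lt. intros Hc. pose proof (sq_le (D a b) (D v b) ltac:(lra)). nra. }
  assert (D a b <= 1.5) by (apply sq_le_inv; nra).
  (* The squared distances to [b] differ by [x v * (2 - x v) >= x v] and the distances sum to at
     most 3, so the edge shortens the distance by at least a third of [x v]. *)
  assert (Hgain : x v <= 20 * (D a b - D v b)).
  { assert ((D a b - D v b) * (D a b + D v b) >= x v) by nra.
    assert ((D a b - D v b) * (D a b + D v b) <= (D a b - D v b) * 3)
      by (apply Rmult_le_compat_l; lra).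
    lra. }
  eapply reach_trans; [apply reach_edge; [exact Gv|exact Dv]|apply (IH v b); try easy; try lra|].
  - intros ->. lra.
  - pose proof (Rmult_le_compat_r (D a b - D v b) 20 C ltac:(lra) HC). lra.
Qed.

(** Only ties at height 1 matter. Points of the open top side are covered by the two assumptions on
    [a] and [b]; a point at the opposite corner lies in the strip for one sign of [e] only, and that
    sign puts it above. *)
Lemma above_box V G D e x y X Y a b a' b' w :
  axes V G D e x y X Y -> In a V -> In b V -> x a = 0 -> x b = 1 ->
  (forall p, y a = 1 -> In p V -> y p = 1 -> 0 < x p < 1 -> Y a < Y p) ->
  (forall p, y b = 1 -> In p V -> y p = 1 -> 0 < x p < 1 -> Y b < Y p) ->
  In a' V -> In b' V -> x a' = 0 -> x b' = 1 -> 0 <= y a' <= 1 -> 0 <= y b' <= 1 ->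
  (a' = a \/ 0 < y a' < 1) -> (b' = b \/ 0 < y b' < 1) ->
  In w V -> X a' < X w < X b' -> 1 <= y w -> Y a' < Y w /\ Y b' < Y w.
Proof.
  intros A Ha Hb xa xb Na Nb Ha' Hb' xa' xb' ya' yb' Ea Eb Hw Xw yw.
  pose proof (ax_wx _ _ _ _ _ _ _ _ A a' w Ha' Hw ltac:(lra)) as xw1.
  pose proof (ax_wx _ _ _ _ _ _ _ _ A w b' Hw Hb' ltac:(lra)) as xw2.
  rewrite xa' in xw1. rewrite xb' in xw2.
  pose proof (ax_X _ _ _ _ _ _ _ _ A) as EX. pose proof (ax_Y _ _ _ _ _ _ _ _ A) as EY.
  pose proof (fun p q => axes_Y_lt _ _ _ _ _ _ _ _ p q A) as YL.
  split.
  - destruct (Rlt_le_dec (y a') (y w)) as [H|H]; [now apply YL|].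
    assert (yw1 : y w = 1) by lra. assert (ya1 : y a' = 1) by lra.
    destruct Ea as [->|Ea]; [|lra].
    destruct (Rle_lt_dec (x w) 0) as [H0|H0].
    { exfalso. assert (a = w) by (apply (axes_eq _ _ _ _ _ _ _ _ a w A); try easy; lra).
      subst; lra. }
    destruct (Rlt_le_dec (x w) 1) as [H1|H1]; [now apply Na|].
    rewrite !EX, xb', yw1 in Xw. rewrite !EY, yw1, ya1, xa'. nra.
  - destruct (Rlt_le_dec (y b') (y w)) as [H|H]; [now apply YL|].
    assert (yw1 : y w = 1) by lra. assert (yb1 : y b' = 1) by lra.
    destruct Eb as [->|Eb]; [|lra].
    destruct (Rlt_le_dec (x w) 1) as [H1|H1].
    2:{ exfalso. assert (b = w) by (apply (axes_eq _ _ _ _ _ _ _ _ b w A); try easy; lra).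
      subst; lra. }
    destruct (Rle_lt_dec (x w) 0) as [H0|H0]; [|now apply Nb].
    rewrite !EX, xa', yw1 in Xw. rewrite !EY, yw1, yb1, xb'. nra.
Qed.

Lemma reach_unit_square V G D e x y X Y a b C :
  axes V G D e x y X Y -> unit_empty V x y -> 20 <= C ->
  In a V -> In b V -> x a = 0 -> x b = 1 -> 0 <= y a <= 1 -> 0 <= y b <= 1 ->
  (Y b - Y a) * (Y b - Y a) <= (X b - X a) * (X b - X a) ->
  shorter_ok V G D x y C (D a b) -> reach G D a b (C * D a b).
Proof.
  intros A U HC Ha Hb xa xb ya yb Hfl IH.
  pose proof (ax_frame _ _ _ _ _ _ _ _ A) as F.
  pose proof (axes_flipx _ _ _ _ _ _ _ _ A) as Ax.
  pose proof (axes_flipy _ _ _ _ _ _ _ _ A) as Ay.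
  pose proof (axes_flipy _ _ _ _ _ _ _ _ Ax) as Axy.
  assert (Uy : unit_empty V x (fun p => 1 - y p)) by (intros w Vw W1 W2; apply (U w); try easy; lra).
  assert (Ux : unit_empty V (fun p => 1 - x p) y) by (intros w Vw W1 W2; apply (U w); try easy; lra).
  assert (Uxy : unit_empty V (fun p => 1 - x p) (fun p => 1 - y p))
    by (intros w Vw W1 W2; apply (U w); try easy; lra).
  assert (neY : forall p q, In p V -> In q V -> x p <> x q -> Y p <> Y q).
  { intros p q Hp Hq N E. apply (fr_Y _ _ _ _ _ F) in E; try easy. now subst. }
  destruct (classic (exists p, y a = 0 /\ In p V /\ y p = 0 /\ 0 < x p < 1 /\ Y a < Y p))
    as [(p & E0 & Hp & yp & xp & Yp)|Na0].
  { now apply (corner V G D e x y X Y a b p C). }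
  destruct (classic (exists p, y a = 1 /\ In p V /\ y p = 1 /\ 0 < x p < 1 /\ Y p < Y a))
    as [(p & E0 & Hp & yp & xp & Yp)|Na1].
  { apply (corner V G D _ _ _ _ _ a b p C Ay); try easy; try lra.
    intros q r Hq Hr N q1 r1 q2 r2 L. apply IH; try easy; lra. }
  destruct (classic (exists p, y b = 0 /\ In p V /\ y p = 0 /\ 0 < x p < 1 /\ Y b < Y p))
    as [(p & E0 & Hp & yp & xp & Yp)|Nb0].
  { apply (frame_reach_sym _ _ _ _ _ _ _ _ F). rewrite (fr_Dsym _ _ _ _ _ a b F).
    apply (corner V G D _ _ _ _ _ b a p C Ax); try easy; try lra.
    intros q r Hq Hr N q1 r1 q2 r2 L. rewrite (fr_Dsym _ _ _ _ _ b a F) in L. apply IH; try easy; lra. }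
  destruct (classic (exists p, y b = 1 /\ In p V /\ y p = 1 /\ 0 < x p < 1 /\ Y p < Y b))
    as [(p & E0 & Hp & yp & xp & Yp)|Nb1].
  { apply (frame_reach_sym _ _ _ _ _ _ _ _ F). rewrite (fr_Dsym _ _ _ _ _ a b F).
    apply (corner V G D _ _ _ _ _ b a p C Axy); try easy; try lra.
    intros q r Hq Hr N q1 r1 q2 r2 L. rewrite (fr_Dsym _ _ _ _ _ b a F) in L. apply IH; try easy; lra. }
  destruct (left_extreme _ _ _ _ _ _ _ _ a A U Ha xa ya) as (a' & Ha' & xa' & Ea & Ma & Xa & Ra).
  destruct (left_extreme _ _ _ _ _ _ _ _ b Ax Ux Hb) as (b' & Hb' & xb' & Eb & Mb & Xb & Rb);
    [lra|easy|].
  assert (xb1 : x b' = 1) by lra. clear xb'.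
  assert (ya' : 0 <= y a' <= 1) by (destruct Ea as [->|Ea]; [easy|lra]).
  assert (yb' : 0 <= y b' <= 1) by (destruct Eb as [->|Eb]; [easy|lra]).
  assert (box : forall w, In w V -> X a' < X w < X b' ->
    (1 <= y w /\ Y a' < Y w /\ Y b' < Y w) \/ (y w <= 0 /\ Y w < Y a' /\ Y w < Y b')).
  { intros w Vw Xw.
    pose proof (ax_wx _ _ _ _ _ _ _ _ A a' w Ha' Vw ltac:(lra)) as xw1.
    pose proof (ax_wx _ _ _ _ _ _ _ _ A w b' Vw Hb' ltac:(lra)) as xw2.
    destruct (Rle_lt_dec 1 (y w)) as [H1|H1].
    { left. split; [easy|].
      apply (above_box V G D e x y X Y a b a' b' w A); try easy.
      - intros p E0 Hp yp xp. apply Rnot_le_lt. intros [Hy|Hy].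
        + apply Na1. exists p. tauto.
        + apply (neY p a Hp Ha); [lra|easy].
      - intros p E0 Hp yp xp. apply Rnot_le_lt. intros [Hy|Hy].
        + apply Nb1. exists p. tauto.
        + apply (neY p b Hp Hb); [lra|easy]. }
    destruct (Rle_lt_dec (y w) 0) as [H0|H0].
    { right. split; [easy|].
      destruct (above_box V G D _ _ _ _ _ a b a' b' w Ay) as [B1 B2]; try easy; try lra.
      - intros p E0 Hp yp xp. apply Rnot_le_lt. intros Hy.
        destruct (Req_dec (Y p) (Y a)) as [Hy'|Hy'].
        + apply (neY p a Hp Ha); [lra|easy].
        + apply Na0. exists p. repeat split; try easy; lra.
      - intros p E0 Hp yp xp. apply Rnot_le_lt. intros Hy.
        destruct (Req_dec (Y p) (Y b)) as [Hy'|Hy'].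
        + apply (neY p b Hp Hb); [lra|easy].
        + apply Nb0. exists p. repeat split; try easy; lra.
      - destruct Ea as [Ea|Ea]; [now left|right; lra].
      - destruct Eb as [Eb|Eb]; [now left|right; lra]. }
    exfalso. destruct (Rle_lt_dec (x w) 0) as [Hx|Hx].
    - assert (X w <= X a') by (apply Ma; try easy; lra). lra.
    - destruct (Rle_lt_dec 1 (x w)) as [Hx'|Hx'].
      + assert (1 - X w <= 1 - X b') by (apply Mb; try easy; lra). lra.
      + apply (U w); easy. }
  pose proof (axes_X_lt _ _ _ _ _ _ _ _ a' b' A Ha' Hb' ltac:(lra)) as Xab.
  (* If the heights of [a'] and [b'] differ by 1, neither point was moved; otherwise flatness is
     strict in [x], [y] and survives the rotation. *)
  assert (Hfl' : (Y b' - Y a') * (Y b' - Y a') <= (X b' - X a') * (X b' - X a')).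
  { destruct (Rlt_le_dec ((y b' - y a') * (y b' - y a')) 1) as [H|H].
    - apply Rlt_le, (ax_flat _ _ _ _ _ _ _ _ A b' a'); try easy. rewrite xb1, xa'. lra.
    - destruct Ea as [->|Ea]; [destruct Eb as [->|Eb]; [easy|]|]; exfalso; nra. }
  assert (R : reach G D a' b' 17).
  { pose proof (ax_e _ _ _ _ _ _ _ _ A) as He.
    destruct (Rlt_le_dec (Y a') (Y b')) as [HY|HY].
    - apply (reach_box V G D e x y X Y). split; try easy;
        try (now apply (ax_X _ _ _ _ _ _ _ _ A)); try (now apply (ax_Y _ _ _ _ _ _ _ _ A));
        try (now apply (ax_D _ _ _ _ _ _ _ _ A)); try (now apply (ax_wx _ _ _ _ _ _ _ _ A));
        try (now apply (ax_wy _ _ _ _ _ _ _ _ A)).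
      apply sq_le_inv; lra.
    - assert (Y a' <> Y b') by (apply neY; try easy; lra).
      apply (reach_box V G D (- e) x (fun p => 1 - y p) (fun p => X p - e) (fun p => 1 - Y p)).
      split; try easy; try lra;
        try (now apply (ax_frame _ _ _ _ _ _ _ _ Ay));
        try (now apply (ax_X _ _ _ _ _ _ _ _ Ay)); try (now apply (ax_Y _ _ _ _ _ _ _ _ Ay));
        try (now apply (ax_D _ _ _ _ _ _ _ _ Ay)); try (now apply (ax_wx _ _ _ _ _ _ _ _ Ay));
        try (now apply (ax_wy _ _ _ _ _ _ _ _ Ay)).
      + apply sq_le_inv; lra.
      + intros w Vw W. destruct (box w Vw) as [B|B]; [lra|right|left]; lra. }
  assert (1 <= D a b).
  { pose proof (fr_D _ _ _ _ _ F a b). apply sq_le_inv; [easy|].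
    rewrite (ax_D _ _ _ _ _ _ _ _ A), xa, xb. pose proof (Rle_0_sqr (y a - y b)). unfold Rsqr in *. lra. }
  apply (frame_reach_sym _ _ _ _ _ _ _ _ F) in Rb.
  eapply reach_trans; [exact Ra|eapply reach_trans; [exact R|exact Rb|apply Rle_refl]|].
  nra.
Qed.

(** * From the unit square to arbitrary empty squares *)

Definition fits (V : list pt) (x y : pt -> R) (p q : pt) : Prop :=
  exists q0 r0 t, 0 < t /\ q0 <= x p <= q0 + t /\ q0 <= x q <= q0 + t /\
    r0 <= y p <= r0 + t /\ r0 <= y q <= r0 + t /\
    forall w, In w V -> q0 < x w < q0 + t -> r0 < y w < r0 + t -> False.

Lemma fits_swap V x y p q : fits V x y p q -> fits V y x p q.
Proof.
  intros (q0 & r0 & t & Ht & H1 & H2 & H3 & H4 & H5).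
  exists r0, q0, t. repeat split; try easy. intros w Vw W1 W2. now apply (H5 w).
Qed.

Lemma fits_sym V x y p q : fits V x y p q -> fits V x y q p.
Proof.
  intros (q0 & r0 & t & Ht & H1 & H2 & H3 & H4 & H5). exists q0, r0, t. tauto.
Qed.

Lemma reach_div G D s p q c :
  0 < s -> reach G D p q c <-> reach G (fun u v => D u v / s) p q (c / s).
Proof.
  intros Hs. assert (E : forall l p, wlen (fun u v => D u v / s) p l = wlen D p l / s).
  { induction l as [|d l IH]; intros r; simpl; [field; lra|rewrite IH; field; lra]. }
  assert (Hi : 0 < / s) by now apply Rinv_0_lt_compat.
  split; intros [l [W L]]; exists l; (split; [easy|]).
  - rewrite E. apply Rmult_le_compat_r; [lra|easy].
  - rewrite E in L. now apply Rmult_le_reg_r in L.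
Qed.

Lemma reach_flat V G D e x y X Y a b C :
  axes V G D e x y X Y -> 20 <= C -> In a V -> In b V -> x a < x b ->
  (Y b - Y a) * (Y b - Y a) <= (X b - X a) * (X b - X a) -> fits V x y a b ->
  (forall p q, In p V -> In q V -> p <> q -> fits V x y p q -> D p q < D a b ->
    reach G D p q (C * D p q)) ->
  reach G D a b (C * D a b).
Proof.
  intros A HC Ha Hb xab Hfl (q0 & r0 & t & Ht & qa & qb & ra & rb & Em) IH.
  set (s := x b - x a). assert (Hs : 0 < s) by (unfold s; lra).
  assert (Hst : s <= t) by (unfold s; lra).
  assert (Hdy : - s <= y b - y a <= s).
  { assert (N : ~ (x b - x a) * (x b - x a) < (y b - y a) * (y b - y a)).
    { intros N. apply (ax_steep _ _ _ _ _ _ _ _ A) in N; try easy. lra. }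
    unfold s; split; apply Rnot_lt_le; intros N1; apply N; nra. }
  assert (exists r1, r0 <= r1 /\ r1 + s <= r0 + t /\ r1 <= y a <= r1 + s /\ r1 <= y b <= r1 + s)
    as (r1 & H1 & H2 & H3 & H4).
  (* The lowest position, inside the given square, of a square of side [s] that covers both heights;
     its left and right sides then pass through [a] and [b]. *)
  { exists (Rmax r0 (Rmax (y a) (y b) - s)).
    unfold Rmax; repeat destruct (Rle_dec _ _); lra. }
  pose proof (ax_X _ _ _ _ _ _ _ _ A) as EX. pose proof (ax_Y _ _ _ _ _ _ _ _ A) as EY.
  assert (A1 : axes V G D e (fun p => x p - x a) (fun p => y p - r1)
    (fun p => X p - (x a + e * r1)) (fun p => Y p - (r1 - e * x a))).
  { apply (axes_congr _ _ _ _ x y X Y); try easy; intros; rewrite ?EX, ?EY; ring. }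
  pose proof (axes_scale _ _ _ _ _ _ _ _ s Hs A1) as A2.
  assert (le1 : forall u, 0 <= u / s <= 1 <-> 0 <= u <= s).
  { intros u. assert (E : u = u / s * s) by (field; lra). rewrite E at 3 4. generalize (u / s). intros k.
    split; intros [K1 K2]; split; [nra|nra|apply Rnot_lt_le; intros T; nra..]. }
  assert (lt1 : forall u, 0 < u / s < 1 -> 0 < u < s).
  { intros u H. assert (E : u = u / s * s) by (field; lra). rewrite E. revert H.
    generalize (u / s). intros k [K1 K2]; split; nra. }
  apply (reach_div _ _ s); [easy|]. unfold Rdiv at 2. rewrite Rmult_assoc.
  refine (reach_unit_square V G _ e _ _ _ _ a b C A2 _ HC Ha Hb _ _ _ _ _ _).
  - intros w Vw W1 W2. apply lt1 in W1; apply lt1 in W2. unfold s in *. apply (Em w); try easy; lra.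
  - field; lra.
  - fold s. field; lra.
  - apply le1; lra.
  - apply le1; lra.
  - unfold Rdiv. rewrite <- !Rmult_minus_distr_r.
    replace (Y b - (r1 - e * x a) - (Y a - (r1 - e * x a))) with (Y b - Y a) by ring.
    replace (X b - (x a + e * r1) - (X a - (x a + e * r1))) with (X b - X a) by ring.
    assert (0 < / s * / s) by (pose proof (Rinv_0_lt_compat s Hs); nra). nra.
  - intros p q Hp Hq N x1 x2 y1 y2 L. apply le1 in x1, x2, y1, y2.
    unfold Rdiv. rewrite <- Rmult_assoc. apply (proj1 (reach_div _ _ s _ _ _ Hs)).
    apply IH; try easy.
    + exists (x a), r1, s. repeat split; try lra.
      intros w Vw W1 W2. unfold s in *. apply (Em w); try easy; lra.
    + apply (Rmult_lt_reg_r (/ s)); [now apply Rinv_0_lt_compat|exact L].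
Qed.

Lemma reach_fits V G D e x y X Y a b C :
  axes V G D e x y X Y -> 20 <= C -> In a V -> In b V -> a <> b -> fits V x y a b ->
  (forall p q, In p V -> In q V -> p <> q -> fits V x y p q -> D p q < D a b ->
    reach G D p q (C * D p q)) ->
  reach G D a b (C * D a b).
Proof.
  assert (flat : forall e x y X Y, axes V G D e x y X Y -> 20 <= C ->
    In a V -> In b V -> a <> b -> fits V x y a b ->
    (forall p q, In p V -> In q V -> p <> q -> fits V x y p q -> D p q < D a b ->
      reach G D p q (C * D p q)) ->
    (Y b - Y a) * (Y b - Y a) <= (X b - X a) * (X b - X a) ->
    reach G D a b (C * D a b)).
  { clear. intros e x y X Y A HC Ha Hb N Hf IH Hfl.
    pose proof (ax_frame _ _ _ _ _ _ _ _ A) as F.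
    destruct (Rtotal_order (x a) (x b)) as [H|[H|H]].
    - now apply (reach_flat V G D e x y X Y).
    - exfalso. assert (Ny : y b <> y a).
      { intros E. apply N. now apply (axes_eq _ _ _ _ _ _ _ _ a b A). }
      assert (S : (x b - x a) * (x b - x a) < (y b - y a) * (y b - y a)).
      { rewrite H. replace (x b - x b) with 0 by ring. rewrite Rmult_0_l.
        apply Rsqr_pos_lt. lra. }
      apply (ax_steep _ _ _ _ _ _ _ _ A) in S; try easy. lra.
    - apply (frame_reach_sym _ _ _ _ _ _ _ _ F). rewrite (fr_Dsym _ _ _ _ _ a b F).
      apply (reach_flat V G D e x y X Y); try easy.
      + lra.
      + now apply fits_sym.
      + intros p q Hp Hq N1 Hf1. rewrite (fr_Dsym _ _ _ _ _ b a F). now apply IH. }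
  intros A HC Ha Hb N Hf IH.
  destruct (Rle_dec ((Y b - Y a) * (Y b - Y a)) ((X b - X a) * (X b - X a))) as [H|H].
  - now apply (flat e x y X Y).
  - apply (flat (- e) y x Y X); try easy.
    + now apply axes_swap.
    + now apply fits_swap.
    + intros p q Hp Hq N1 Hf1. apply IH; try easy. now apply fits_swap.
    + lra.
Qed.

(** * The rotation *)

(** Each positive [u] tolerates a perturbation below [u / (1 + Rabs v)]; finitely many such
    thresholds have a positive minimum. *)
Lemma small_eps (l : list (R * R)) :
  exists eps, 0 < eps <= 1 / 100 /\ forall u v, In (u, v) l -> 0 < u -> eps * v < u.
Proof.
  induction l as [|[u v] l [eps [He IH]]].
  - exists (1 / 100). split; [lra|easy].
  - destruct (Rlt_le_dec 0 u) as [Hu|Hu].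
    2:{ exists eps. split; [easy|]. intros u' v' [E|H] H1; [injection E; intros; lra|auto]. }
    assert (Hd : 0 < 1 + Rabs v) by (pose proof (Rabs_pos v); lra).
    set (d := u / (1 + Rabs v)).
    assert (Hd0 : 0 < d) by (apply Rdiv_lt_0_compat; easy).
    exists (Rmin eps d). pose proof (Rmin_l eps d). pose proof (Rmin_r eps d).
    assert (0 < Rmin eps d) by (apply Rmin_glb_lt; lra).
    split; [lra|]. intros u' v' [E|Hl] H'.
    + injection E as <- <-. assert (d * (1 + Rabs v) = u) by (unfold d; field; lra).
      pose proof (Rle_abs v). pose proof (Rabs_pos v).
      pose proof (Rmult_le_compat_r (Rabs v) (Rmin eps d) d ltac:(lra) ltac:(lra)).
      pose proof (Rmult_le_compat_l (Rmin eps d) v (Rabs v) ltac:(lra) ltac:(lra)). lra.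
    + specialize (IH u' v' Hl H'). destruct (Rle_dec 0 v').
      * pose proof (Rmult_le_compat_r v' (Rmin eps d) eps ltac:(lra) ltac:(lra)). lra.
      * pose proof (Rmult_le_compat_l (Rmin eps d) v' 0 ltac:(lra) ltac:(lra)). lra.
Qed.

Lemma dist2_sq p q :
  dist2 p q * dist2 p q
    = (fst p - fst q) * (fst p - fst q) + (snd p - snd q) * (snd p - snd q).
Proof. unfold dist2. rewrite sqrt_sqrt; [ring|].
  pose proof (pow2_ge_0 (fst p - fst q)). pose proof (pow2_ge_0 (snd p - snd q)). lra.
Qed.

Lemma yao_quadrant_cone V E i X Y :
  yao4_directed V E -> (1 <= i <= 4)%nat ->
  (forall u v, In u V -> In v V -> in_cone i u v <-> X u < X v /\ Y u < Y v) ->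
  yao_quadrant V (Y4 E) dist2 X Y.
Proof.
  intros (H1 & H2 & _) Hi Hc u w Hu Hw Xw Yw.
  destruct (H2 u i Hu Hi) as (v & Euv & Cv).
  { exists w. split; [easy|]. now apply Hc. }
  destruct (H1 u v Euv) as (_ & Hv & j & Hj & Cj & Min).
  assert (j = i) as ->.
  { assert (Di : (i = 1 \/ i = 2 \/ i = 3 \/ i = 4)%nat) by lia.
    assert (Dj : (j = 1 \/ j = 2 \/ j = 3 \/ j = 4)%nat) by lia.
    clear - Cv Cj Di Dj.
    destruct Di as [->|[->|[->| ->]]]; destruct Dj as [->|[->|[->| ->]]]; simpl in *; easy || lra. }
  exists v. split; [easy|]. split; [now left|].
  split; [now apply Hc|]. split; [now apply Hc|].
  intros w' Vw' W1 W2. apply Min; [easy|]. now apply Hc.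
Qed.

(** The four conditions keep nonzero coordinates from changing sign, so the turn affects only
    vectors on the axes: it moves the included ray into the open quadrant and the excluded ray out
    of it. Quarter turns of [(p, q)] give the other cones. *)
Lemma cone_rotate eps p q :
  0 < eps -> (0 < p -> eps * q < p) -> (0 < q -> eps * - p < q) ->
  (0 < - p -> eps * - q < - p) -> (0 < - q -> eps * p < - q) ->
  (0 < p /\ 0 <= q <-> 0 < p - eps * q /\ 0 < q + eps * p).
Proof.
  intros He P1 P2 P3 P4. split; intros [H1 H2].
  - assert (0 < eps * p) by now apply Rmult_lt_0_compat. specialize (P1 H1). lra.
  - assert (0 <= q) by (apply Rnot_lt_le; intros T; assert (eps * p < - q) by (apply P4; lra); lra).
    split; [|easy]. apply Rnot_le_lt. intros [T|T].
    + assert (eps * - q < - p) by (apply P3; lra). lra.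
    + subst p. assert (0 <= eps * q) by (apply Rmult_le_pos; lra). lra.
Qed.

Lemma rotated_axes V E :
  yao4_directed V E ->
  exists e, axes V (Y4 E) dist2 e fst snd (fun p => fst p + e * snd p) (fun p => snd p - e * fst p).
Proof.
  intros HE.
  pose (dx := fun pq : pt * pt => fst (snd pq) - fst (fst pq)).
  pose (dy := fun pq : pt * pt => snd (snd pq) - snd (fst pq)).
  pose (pairs := list_prod V V).
  destruct (small_eps (map (fun w => (dx w, dy w)) pairs ++ map (fun w => (dy w, - dx w)) pairs
    (* X^2 - Y^2 = (1 - eps^2) (dx^2 - dy^2) - 4 eps dx dy must have the sign of dx^2 - dy^2 *)
    ++ map (fun w => (dx w * dx w - dy w * dy w, 8 * dx w * dy w)) pairs
    ++ map (fun w => (dy w * dy w - dx w * dx w, - 8 * dx w * dy w)) pairs))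
    as (eps & He & Hs).
  assert (Q : forall p q, In p V -> In q V ->
    let u := fst q - fst p in let v := snd q - snd p in
    (0 < u -> eps * v < u) /\ (0 < v -> eps * - u < v) /\
    (0 < u * u - v * v -> eps * (8 * u * v) < u * u - v * v) /\
    (0 < v * v - u * u -> eps * (- 8 * u * v) < v * v - u * u)).
  { intros p q Hp Hq u v. assert (Hpq : In (p, q) pairs) by now apply in_prod.
    repeat split; apply Hs; rewrite !in_app_iff, !in_map_iff.
    - left. now exists (p, q).
    - right; left. now exists (p, q).
    - right; right; left. now exists (p, q).
    - right; right; right. now exists (p, q). }
  clear Hs.
  set (X := fun p : pt => fst p + - eps * snd p). set (Y := fun p : pt => snd p - - eps * fst p).
  assert (dX : forall u v, X v - X u = (fst v - fst u) - eps * (snd v - snd u))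
    by (intros; unfold X; ring).
  assert (dY : forall u v, Y v - Y u = (snd v - snd u) + eps * (fst v - fst u))
    by (intros; unfold Y; ring).
  assert (Q' : forall u v, In u V -> In v V ->
    let p := fst v - fst u in let q := snd v - snd u in
    (0 < p -> eps * q < p) /\ (0 < q -> eps * - p < q) /\
    (0 < - p -> eps * - q < - p) /\ (0 < - q -> eps * p < - q)).
  { intros u v Hu Hv p q. destruct (Q u v Hu Hv) as (P1 & P2 & _).
    destruct (Q v u Hv Hu) as (P3 & P4 & _).
    replace (fst u - fst v) with (- p) in * by (unfold p; ring).
    replace (snd u - snd v) with (- q) in * by (unfold q; ring).
    rewrite Ropp_involutive in P4. auto. }
  assert (c1 : forall u v, In u V -> In v V -> in_cone 1 u v <-> X u < X v /\ Y u < Y v).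
  { intros u v Hu Hv. destruct (Q' u v Hu Hv) as (P1 & P2 & P3 & P4).
    pose proof (cone_rotate eps _ _ ltac:(lra) P1 P2 P3 P4).
    specialize (dX u v). specialize (dY u v). simpl. split; intros; lra. }
  assert (c2 : forall u v, In u V -> In v V -> in_cone 2 u v <-> opp X u < opp X v /\ Y u < Y v).
  { intros u v Hu Hv. destruct (Q' u v Hu Hv) as (P1 & P2 & P3 & P4). cbv zeta in *.
    pose proof (cone_rotate eps (snd v - snd u) (- (fst v - fst u))
      ltac:(lra) ltac:(lra) ltac:(lra) ltac:(lra) ltac:(lra)).
    specialize (dX u v). specialize (dY u v). simpl. unfold opp. split; intros; lra. }
  assert (c3 : forall u v, In u V -> In v V -> in_cone 3 u v <-> opp X u < opp X v /\ opp Y u < opp Y v).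
  { intros u v Hu Hv. destruct (Q' u v Hu Hv) as (P1 & P2 & P3 & P4). cbv zeta in *.
    pose proof (cone_rotate eps (- (fst v - fst u)) (- (snd v - snd u))
      ltac:(lra) ltac:(lra) ltac:(lra) ltac:(lra) ltac:(lra)).
    specialize (dX u v). specialize (dY u v). simpl. unfold opp. split; intros; lra. }
  assert (c4 : forall u v, In u V -> In v V -> in_cone 4 u v <-> X u < X v /\ opp Y u < opp Y v).
  { intros u v Hu Hv. destruct (Q' u v Hu Hv) as (P1 & P2 & P3 & P4). cbv zeta in *.
    pose proof (cone_rotate eps (- (snd v - snd u)) (fst v - fst u)
      ltac:(lra) ltac:(lra) ltac:(lra) ltac:(lra) ltac:(lra)).
    specialize (dX u v). specialize (dY u v). simpl. unfold opp. split; intros; lra. }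
  assert (eq_of_sq : forall u v,
    (fst v - fst u) * (fst v - fst u) + (snd v - snd u) * (snd v - snd u) = 0 -> u = v).
  { intros [u1 u2] [v1 v2]. simpl. intros H. apply Rplus_sqr_eq_0 in H. f_equal; lra. }
  assert (eps0 : 0 <= eps * eps <= 1 / 100) by nra.
  (* The negative sign turns difference vectors counterclockwise, away from the included clockwise
     ray. *)
  exists (- eps). split; try easy.
  - split.
    + intros p q [H|H]; [now right|now left].
    + intros p q. apply sqrt_pos.
    + exists (1 + eps * eps). split; [lra|]. intros p q. rewrite dist2_sq. unfold X, Y. ring.
    + intros p q Hp Hq H. change (X p = X q) in H. apply eq_of_sq.
      destruct (Q' p q Hp Hq) as (P1 & P2 & P3 & P4). cbv zeta in *.
      specialize (dX p q).
      set (u := fst q - fst p) in *. set (v := snd q - snd p) in *.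
      destruct (Rtotal_order u 0) as [T|[T|T]].
      * assert (eps * - v < - u) by (apply P3; lra). lra.
      * assert (Z : v = 0) by (apply (Rmult_eq_reg_l eps); lra). rewrite T, Z. ring.
      * assert (eps * v < u) by (apply P1; lra). lra.
    + intros p q Hp Hq H. change (Y p = Y q) in H. apply eq_of_sq.
      destruct (Q' p q Hp Hq) as (P1 & P2 & P3 & P4). cbv zeta in *.
      specialize (dY p q).
      set (u := fst q - fst p) in *. set (v := snd q - snd p) in *.
      destruct (Rtotal_order v 0) as [T|[T|T]].
      * assert (eps * u < - v) by (apply P4; lra). lra.
      * assert (Z : u = 0) by (apply (Rmult_eq_reg_l eps); lra). rewrite T, Z. ring.
      * assert (eps * - u < v) by (apply P2; lra). lra.
    + apply (yao_quadrant_cone V E 1); try easy; lia.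
    + apply (yao_quadrant_cone V E 2); try easy; lia.
    + apply (yao_quadrant_cone V E 4); try easy; lia.
    + apply (yao_quadrant_cone V E 3); try easy; lia.
  - apply dist2_sq.
  - lra.
  - intros p q Hp Hq H. change (X p < X q) in H.
    destruct (Q' p q Hp Hq) as (P1 & P2 & P3 & P4). cbv zeta in *.
    specialize (dX p q). apply Rnot_lt_le. intros T.
    assert (eps * - (snd q - snd p) < - (fst q - fst p)) by (apply P3; lra). lra.
  - intros p q Hp Hq H. change (Y p < Y q) in H.
    destruct (Q' p q Hp Hq) as (P1 & P2 & P3 & P4). cbv zeta in *.
    specialize (dY p q). apply Rnot_lt_le. intros T.
    assert (eps * (fst q - fst p) < - (snd q - snd p)) by (apply P4; lra). lra.
  - intros q p Hq Hp H.
    change ((Y q - Y p) * (Y q - Y p) < (X q - X p) * (X q - X p)).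
    destruct (Q p q Hp Hq) as (_ & _ & P & _). cbv zeta in P.
    rewrite dX, dY. set (u := fst q - fst p) in *. set (v := snd q - snd p) in *.
    assert (eps * (8 * u * v) < u * u - v * v) by (apply P; lra).
    assert (0 <= (u * u - v * v) * (1 / 100 - eps * eps)) by (apply Rmult_le_pos; lra). lra.
  - intros q p Hq Hp H. change ((X q - X p) * (X q - X p) < (Y q - Y p) * (Y q - Y p)).
    destruct (Q p q Hp Hq) as (_ & _ & _ & P). cbv zeta in P.
    rewrite dX, dY. set (u := fst q - fst p) in *. set (v := snd q - snd p) in *.
    assert (eps * (- 8 * u * v) < v * v - u * u) by (apply P; lra).
    assert (0 <= (v * v - u * u) * (1 / 100 - eps * eps)) by (apply Rmult_le_pos; lra). lra.
Qed.

Theorem theorem3 (V : list pt) (E : pt -> pt -> Prop)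
  (HE : yao4_directed V E) (a b : pt) (Hab : del_inf_edge V a b) :
  exists p : list pt,
    walk (Y4 E) a p b /\ walk_len a p <= (11 + 7 * sqrt 2) * dist2 a b.
Proof.
  destruct Hab as (Ha & Hb & N & x0 & y0 & s & Hs & (xa & ya & _) & (xb & yb & _) & Em).
  destruct (rotated_axes V E HE) as [e A].
  assert (HC : 20 <= 11 + 7 * sqrt 2) by (pose proof sqrt2_bounds; lra).
  assert (main : forall a b, In a V -> In b V -> a <> b -> fits V fst snd a b ->
    reach (Y4 E) dist2 a b ((11 + 7 * sqrt 2) * dist2 a b)).
  { apply (pair_real_ind V dist2 (fun p q => p <> q -> fits V fst snd p q ->
      reach (Y4 E) dist2 p q ((11 + 7 * sqrt 2) * dist2 p q))). intros p q Hp Hq IH Npq Hf.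
    apply (reach_fits V (Y4 E) dist2 _ _ _ _ _ p q _ A); try easy. auto. }
  destruct (main a b Ha Hb N) as (l & W & L).
  - exists x0, y0, s. repeat split; try easy. intros w Vw W1 W2. now apply (Em w).
  - exists l. split; [easy|]. replace (walk_len a l) with (wlen dist2 a l); [easy|].
    clear. revert a. induction l as [|c l IH]; intros a; simpl; [easy|now rewrite IH].
Qed.
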